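(* Let $n\ge1$ and let $A_1(\omega),\ldots,A_n(\omega)$ be a.e. disjoint random Borel subsets of $X$, all of them a.s. contained in a fixed compact set $K$ of $X$. Then for all $k_1,\ldots,k_n\in\mathbb{N}$, with $N=k_1+\cdots+k_n$, $$E_\sigma\Big[\prod_{i=1}^nC_{k_i}\big(\delta(\mathbf{1}_{A_i})+\sigma(A_i),\sigma(A_i)\big)\Big] =E_\sigma\Big[\int_{K^N}\Delta_{s_1}\cdots\Delta_{s_N}\big(\mathbf{1}_{A_1^{k_1}}\otimes\cdots\otimes\mathbf{1}_{A_n^{k_n}}\big)(s_1,\ldots,s_N)\,\sigma(ds_1)\cdots\sigma(ds_N)\Big].$$
   Context: $X$ is a $\sigma$-compact metric space with Borel $\sigma$-algebra, $\sigma$ is a $\sigma$-finite diffuse (atomless) measure on $X$, finite on compact sets. $\Omega^X$ is the space of at most countable, locally finite subsets $\omega$ of $X$, identified with point measures $\omega(dx)=\sum_{x\in\omega}\epsilon_x$; $\pi_\sigma$ is the Poisson probability measure on $\Omega^X$ with intensity $\sigma$ and $E_\sigma$ is expectation under $\pi_\sigma$. A random Borel set $A(\omega)$ is one for which $(\omega,x)\mapsto\mathbf{1}_{A(\omega)}(x)$ is measurable on $\Omega^X\times X$. The Charlier polynomials $C_n(x,\lambda)$ are defined by $e^{-r\lambda}(1+r)^x=\sum_{n=0}^\infty\frac{r^n}{n!}C_n(x,\lambda)$, $r>-1$. The finite difference gradient is $D_xF(\omega)=F(\omega\cup\{x\})-F(\omega)$. The Poisson–Skorohod integral of a measurable process $u:\Omega^X\times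 X\to\mathbb{R}$ with $E_\sigma[\int_X|u(\omega,t)|\sigma(dt)]<\infty$ is $$\delta(u)(\omega)=\int_Xu(\omega\setminus\{t\},t)\,(\omega(dt)-\sigma(dt)).$$ Symbolic notation $\Delta$: for measurable processes $u^{(1)},\ldots,u^{(N)}$ on $\Omega^X\times X$ and $s_1,\ldots,s_N\in X$, $$\Delta_{s_1}\cdots\Delta_{s_N}\prod_{p=1}^Nu^{(p)}_{s_p}:=\sum_{\substack{\Theta_1\cup\cdots\cup\Theta_N=\{1,\ldots,N\}\\ 1\notin\Theta_1,\ldots,N\notin\Theta_N}}D_{\Theta_1}u^{(1)}_{s_1}\cdots D_{\Theta_N}u^{(N)}_{s_N},\qquad D_\Theta:=\prod_{j\in\Theta}D_{s_j},$$ where the $\Theta_p$ are (not necessarily disjoint, possibly empty) subsets of $\{1,\ldots,N\}$, $D_\varnothing$ is the identity, and $D_{s_j}$ acts on the variable $\omega$ only. In the claim this is applied with $(\mathbf{1}_{A_1^{k_1}}\otimes\cdots\otimes\mathbf{1}_{A_n^{k_n}})(s_1,\ldots,s_N)=\prod_{p=1}^N\mathbf{1}_{A_{i(p)}}(s_p)$, where $i(p)=i$ for $k_1+\cdots+k_{i-1}<p\le k_1+\cdots+k_i$. *)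

(* Defs.v *)
From HB Require Import structures.
From mathcomp Require Import all_boot all_order all_algebra.
From mathcomp Require Import all_classical all_reals all_analysis measurable_realfun.

Set Implicit Arguments.
Unset Strict Implicit.
Unset Printing Implicit Defensive.

Import Order.TTheory GRing.Theory Num.Theory.
Import numFieldNormedType.Exports.

Local Open Scope classical_set_scope.
Local Open Scope ring_scope.

HB.mixin Record Measurable_isBorel (d : measure_display) (R : numDomainType) X
    & Measurable d X & Metric R X := {
  measurable_borel : @measurable d X = <<s @open X >>
}.

#[short(type="borelMetricType")]
HB.structure Definition BorelMetric d (R : numDomainType) :=
  { X of Measurable d X & Metric R X & Measurable_isBorel d R X }.

Definition sigma_compact (X : topologicalType) : Prop :=
  exists K : (set X)^nat,
    (forall n, compact (K n)) /\ \bigcup_n K n = [set: X].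

Definition locally_finite (X : topologicalType) (w : set X) : Prop :=
  forall x : X, exists2 U, nbhs x U & finite_set (w `&` U).

Record config (X : topologicalType) := Config {
  points :> set X ;
  countable_points : countable points ;
  locally_finite_points : locally_finite points }.
Arguments Config {X points}.

Section config_ops.
Context {X : topologicalType}.
Implicit Types (w : config X) (x : X).

Lemma config_eq w w' : w = w' :> set X -> w = w'.
Proof.
case: w w' => [v cv fv] [v' cv' fv'] /= vv'; rewrite {v}vv' in cv fv *.
by congr Config; exact: Prop_irrelevance.
Qed.

Lemma countable_add w x : countable (w `|` [set x]).
Proof.
rewrite -bigcup2E; apply: bigcup_countable => // -[|[|i]] _ //=.
exact: countable_points.
Qed.

Lemma locally_finite_add w x : locally_finite (w `|` [set x]).
Proof.
move=> y; have [U Uy fU] := locally_finite_points w y.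
exists U => //; rewrite setIUl finite_setU; split=> //.
exact/finite_setIl/finite_set1.
Qed.

Definition add_pt w x := Config (countable_add w x) (locally_finite_add w x).

Lemma countable_del w x : countable (w `\ x).
Proof. exact: sub_countable (subset_card_le (@subDsetl _ _ _)) (countable_points w). Qed.

Lemma locally_finite_del w x : locally_finite (w `\ x).
Proof.
move=> y; have [U Uy fU] := locally_finite_points w y.
by exists U => //; apply: sub_finite_set fU; apply: setSI; exact: subDsetl.
Qed.

Definition del_pt w x := Config (countable_del w x) (locally_finite_del w x).

Lemma countable_no_pt : countable (set0 : set X).
Proof. exact: countable0. Qed.

Lemma locally_finite_no_pt : locally_finite (set0 : set X).
Proof. by move=> x; exists setT; [exact: filterT | rewrite set0I]. Qed.

HB.instance Definition _ := gen_eqMixin (config X).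
HB.instance Definition _ := gen_choiceMixin (config X).
HB.instance Definition _ := isPointed.Build (config X)
  (Config countable_no_pt locally_finite_no_pt).

End config_ops.

Section point_measure.
Context {d} {R : realType} {X : borelMetricType d R}.
Local Open Scope ereal_scope.

Definition point_measure (w : config X) (B : set X) : \bar R :=
  \esum_(x in w) \d_x B.

Section instance.
Variable w : config X.

Let pm0 : point_measure w set0 = 0.
Proof. by rewrite /point_measure esum1// => x _; rewrite measure0. Qed.

Let pm_ge0 B : 0 <= point_measure w B.
Proof. by apply: esum_ge0. Qed.

Let pm_sigma_additive : semi_sigma_additive (point_measure w).
Proof.
move=> F mF tF mUF; apply: cvg_toP.
  by apply: is_cvg_ereal_nneg_natsum => n _; exact: pm_ge0.
rewrite [LHS](_ : _ = \sum_(n <oo) \esum_(x in w) \d_x (F n)); last by [].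
rewrite nneseries_esumT; last by move=> n; apply: esum_ge0.
rewrite esum_esum//.
rewrite (_ : point_measure w (\bigcup_n F n) =
    \esum_(x in w) \esum_(n in [set: nat]) \d_x (F n)); last first.
  apply: eq_esum => x _.
  by rewrite measure_semi_bigcup// nneseries_esumT.
rewrite esum_esum//.
rewrite (reindex_esum (w `*`` (fun=> [set: nat]))
  ([set: nat] `*`` (fun=> w : set X)) (fun z => (z.2, z.1)))//; split=> //=.
- by move=> [i1 i2] [].
- by move=> [i1 i2] [j1 j2] /= _ _ [] -> ->.
- by move=> [i1 i2] [Pi1 Qi2] /=; exists (i2, i1).
Qed.

HB.instance Definition _ := isMeasure.Build _ _ _ (point_measure w)
  pm0 pm_ge0 pm_sigma_additive.
End instance.
End point_measure.

Section config_measurable.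
Context {d} {R : realType} {X : borelMetricType d R}.

(* The sigma-algebra generated by the counting maps [w |-> w(B)], B Borel. *)
Definition config_generators : set (set (config X)) :=
  \bigcup_(B in @measurable d X)
    preimage_set_system setT (fun w : config X => point_measure w B)
      (measurable : set (set (\bar R))).

HB.instance Definition _ := @isMeasurable.Build
  (sigma_display config_generators) (config X) <<s config_generators >>
  (@sigma_algebra0 _ setT config_generators)
  (@sigma_algebraC _ config_generators)
  (@sigma_algebra_bigcup _ setT config_generators).

End config_measurable.

(* [w(B_i)], for disjoint Borel sets [B_i] of finite intensity, are independent
   Poisson variables of parameters [sigma B_i].  The probability mass function
   is written out because the library's [poisson_pmf] is constantly 1 at
   rate 0. *)
Definition is_poisson d (R : realType) (X : borelMetricType d R)
    (sigma : set X -> \bar R) (P : set (config X) -> \bar R) : Prop :=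
  (forall (B : set X) (k : nat), measurable B -> (sigma B < +oo)%E ->
     P [set w | point_measure w B = k%:R%:E] =
     (expR (- fine (sigma B)) * fine (sigma B) ^+ k / k`!%:R)%:E) /\
  (forall (m : nat) (B : 'I_m -> set X) (k : 'I_m -> nat),
     (forall i, measurable (B i)) -> (forall i, (sigma (B i) < +oo)%E) ->
     trivIset setT B ->
     P (\bigcap_i [set w | point_measure w (B i) = (k i)%:R%:E]) =
     (\prod_(i < m) P [set w | point_measure w (B i) = (k i)%:R%:E])%E).

(* Power series in r at fixed x and lam; for x outside the natural numbers it
   diverges when r > 1, so the identity is required on -1 < r < 1 only, which
   already determines C. *)
Definition is_charlier (R : realType) (C : nat -> R -> R -> R) : Prop :=
  forall x lam r : R, -1 < r -> r < 1 ->
    series (fun n => r ^+ n / n`!%:R * C n x lam) @ \oo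
      --> expR (- (r * lam)) * (1 + r) `^ x.

Section difference.
Context {R : realType} {X : topologicalType}.

Definition diff_at (x : X) (F : config X -> R) (w : config X) : R :=
  F (add_pt w x) - F w.

Definition diff_on N (s : N.-tuple X) (Th : {set 'I_N}) (F : config X -> R) :
    config X -> R :=
  foldr (fun j => diff_at (tnth s j)) F (enum Th).

Definition Delta N (u : 'I_N -> config X -> X -> R) (s : N.-tuple X)
    (w : config X) : R :=
  \sum_(Th : {ffun 'I_N -> {set 'I_N}} |
        (\bigcup_p Th p == [set: 'I_N])%SET && [forall p, p \notin Th p])
    \prod_(p < N) diff_on s (Th p) (fun w' => u p w' (tnth s p)) w.

End difference.

(* The factor index i(p) of the p-th variable, when the variables are split in
   consecutive blocks of lengths k_0, ..., k_(n-1); indices start at 0. *)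
Definition block n (k : 'I_n -> nat) (p : 'I_(\sum_(i < n) k i)) : 'I_n :=
  tagnat.sig1 p.

Lemma blockP n (k : 'I_n -> nat) (p : 'I_(\sum_(i < n) k i)) :
  (\sum_(j < n | (j < block p)%N) k j <= p <
   \sum_(j < n | (j <= block p)%N) k j)%N.
Proof.
rewrite [X in (_ <= X < _)%N](tagnat.rect p) leq_addr /=.
rewrite [ltnRHS](bigD1 (block p))//= addnC.
rewrite [X in (_ < _ + X)%N](eq_bigl (fun j : 'I_n => (j < block p)%N)).
  by rewrite ltn_add2r.
by move=> j /=; rewrite [RHS]ltn_neqAle andbC.
Qed.

Section skorohod.
Context {d} {R : realType} {X : borelMetricType d R}.
Variable sigma : {measure set X -> \bar R}.

Definition random_set (A : config X -> set X) : Prop :=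
  measurable_fun [set: config X * X] (fun p => \1_(A p.1) p.2 : R).

(* Both integrals are [fine]d Lebesgue integrals, meaningful where u is
   integrable against w and sigma, hence almost surely when
   E[\int |u| dsigma] is finite. *)
Definition skorohod (u : config X -> X -> R) (w : config X) : R :=
  \int[point_measure w]_t u (del_pt w t) t - \int[sigma]_t u (del_pt w t) t.

(* Integral over K^N against sigma(ds_1)...sigma(ds_N), ds_1 outermost. *)
Fixpoint iter_integral (K : set X) N : (N.-tuple X -> R) -> R :=
  match N with
  | 0 => fun f => f [tuple]
  | N'.+1 => fun f =>
      \int[sigma]_(x in K) iter_integral K (fun s => f [tuple of x :: s])
  end.

End skorohod.

(* Main.v *)
From HB Require Import structures.
Require Import Defs.
From mathcomp Require Import finmap.
From mathcomp Require Import all_boot all_order all_algebra.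
From mathcomp Require Import all_classical all_reals all_analysis measurable_realfun.
From mathcomp Require Import ring lra.

Set Implicit Arguments.
Unset Strict Implicit.
Unset Printing Implicit Defensive.

Import Order.TTheory GRing.Theory Num.Theory.
Import numFieldNormedType.Exports.

Local Open Scope classical_set_scope.
Local Open Scope ring_scope.

(** The identity compares two ways of counting.  Let N_i(w) be the number of
points t of w that lie in A_i(w \ t).  A configuration is countable and sigma
is diffuse, so removing t from w does not affect sigma(A_i(w)), and
delta(1_(A_i)) + sigma(A_i) is exactly N_i ([skorohod_indic]).  The left-hand
side is thus the expectation of the product of the C_(k_i)(N_i, sigma(A_i)).

At natural numbers the Charlier polynomials satisfy
C_(k+1)(x, l) = x C_k(x - 1, l) - l C_k(x, l) ([charlier_rec]).  Unfolding this
recurrence over the N = k_1 + ... + k_n variables turns the product into a sum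
over the sets S of variables, with sign (-1)^(N - |S|) ([sum_mixed_monomial]):
a variable p of S picks a point counted by N_(i(p)) that no other variable of S
has picked, and a variable p outside S contributes sigma(A_(i(p))).  Such a term
is an iterated integral of the product over p of 1_(A_(i(p)))(s_p), where the
variables of S are integrated against w, the others against sigma, and
A_(i(p)) is taken at (w minus the points picked by S) together with the s_q for
q in S \ p ([mixed_shifted_product]).  Requiring distinct points between
different indices i changes nothing, because almost surely no point is counted
by two of the N_i ([mecke_ae]); this is where disjointness is used.

The Mecke formula, that the expected sum of f(w, t) over the points t of w is
the integral of E f(w + t, t) against sigma ([mecke_formula]), replaces one
integral against w by an integral against sigma.  Applied to the variables of S
in turn it makes the configuration whole again and leaves the integral over K^N
of the product of the 1_(A_(i(p))(w + s_(S \ p)))(s_p)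
([integral_mixed_integral]).  All integrands are nonnegative up to this point,
so integrability is only needed to add up the finitely many terms, each at most
sigma(K)^N.  Since the sum of D_Theta over the subsets Theta of T is the shift
by the points s_T, Moebius inversion over S shows that the signed sum of these
products is the symbol Delta, pointwise ([Delta_inclusion_exclusion]).

The Mecke formula is an equality of two measures on pairs (configuration,
point).  Events that fix the numbers of points in finitely many subsets of a
compact set generate everything and are stable under intersection; cutting the
compact set into the atoms of these subsets reduces the equality to disjoint
sets, where it is the identity l p_l = lambda p_(l - 1) of the Poisson
weights ([mecke_atom]). *)

(** * Adding and deleting points *)

Section config_algebra.
Context {X : topologicalType}.
Implicit Types (w : config X) (x : X).

Lemma add_pt_id w x : points w x -> add_pt w x = w.
Proof.
move=> wx; apply: config_eq; apply/seteqP; split => [y|y wy]; last by left.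
by case=> [//|->].
Qed.

Lemma del_pt_id w x : ~ points w x -> del_pt w x = w.
Proof.
move=> wx; apply: config_eq; apply/seteqP; split => [y []//|y wy].
by split=> // yx; apply: wx; rewrite -yx.
Qed.

Lemma del_ptK w x : points w x -> add_pt (del_pt w x) x = w.
Proof.
move=> wx; apply: config_eq; apply/seteqP; split => [y [[]//|->//]|y wy] /=.
by have [->|/eqP yx] := eqVneq y x; [right|left].
Qed.

Lemma add_ptK w x : ~ points w x -> del_pt (add_pt w x) x = w.
Proof.
move=> wx; apply: config_eq; apply/seteqP; split => [y [[]//]|y wy] /=.
by split; [left|move=> yx; apply: wx; rewrite -yx].
Qed.

End config_algebra.

Section borel_sets.
Context {d} {R : realType} {X : borelMetricType d R}.

Lemma measurable_open (U : set X) : open U -> measurable U.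
Proof. by rewrite measurable_borel; exact: sub_sigma_algebra. Qed.

Lemma measurable_closed (U : set X) : closed U -> measurable U.
Proof.
by move=> cU; rewrite -(setCK U); apply/measurableC/measurable_open/closed_openC.
Qed.

Lemma measurable_compact (L : set X) : compact L -> measurable L.
Proof.
by move=> cL; apply: measurable_closed; apply: compact_closed => //; exact: metric_hausdorff.
Qed.

Lemma measurable_point (x : X) : measurable [set x].
Proof. exact/measurable_compact/compact_set1. Qed.

Lemma measurable_countable (D : set X) : countable D -> measurable D.
Proof.
by apply: countable_measurable => x; exact: measurable_point.
Qed.

End borel_sets.

(** * Counting points *)

Section counting.
Context {d} {R : realType} {X : borelMetricType d R}.
Implicit Types (w : config X) (x : X) (B L : set X).

(** Finitely many of the neighbourhoods given by local finiteness cover L. *)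
Lemma finite_config_compact w L : compact L -> finite_set (w `&` L).
Proof.
rewrite compact_cover => cL.
pose U x := (sval (cid2 (locally_finite_points w x)))°.
have fU x : finite_set (w `&` U x).
  rewrite /U; case: cid2 => V /= _; apply: sub_finite_set.
  by apply: setIS; exact: interior_subset.
have [x _|x Lx|D _ LD] := cL X setT U.
- exact: open_interior.
- by exists x => //; rewrite /U; case: cid2 => V.
- apply: (sub_finite_set (setIS LD)); rewrite /cover setI_bigcupr.
  by apply: bigcup_finite => // x _; exact: fU.
Qed.

(** Meaningful when B meets w in a finite set, in particular inside a compact
set; there it replaces the extended real [point_measure w B]. *)
Definition npts w B : nat := #|` fset_set (w `&` B)|.

Lemma point_measureI w B : point_measure w (w `&` B) = point_measure w B :> \bar R.
Proof.
by apply: eq_esum => x wx; rewrite !diracE in_setI (mem_set wx).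
Qed.

Lemma point_measure_npts w B : finite_set (w `&` B) ->
  point_measure w B = (npts w B)%:R%:E :> \bar R.
Proof.
move=> fwB; rewrite /point_measure (esumID B)//.
rewrite [X in (_ + X)%E]esum1 ?adde0; last first.
  by move=> x [_ Bx]; rewrite diracE memNset.
rewrite (eq_esum (b := fun=> 1%E)); last by move=> x [_ Bx]; rewrite diracE mem_set.
rewrite esum_fset// fsbig_finite//= big_const_seq count_predT.
rewrite /npts; elim: (size _) => [//|n IHn].
by rewrite iterS IHn -EFinD -natr1 addrC.
Qed.

Lemma point_measure_compact w L B : compact L -> B `<=` L ->
  point_measure w B = (npts w B)%:R%:E :> \bar R.
Proof.
move=> cL BL; apply: point_measure_npts.
by apply: sub_finite_set (finite_config_compact w cL); exact: setIS.
Qed.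

Lemma point_measure_add w x B : ~ points w x ->
  point_measure (add_pt w x) B = (point_measure w B + \d_x B)%E :> \bar R.
Proof.
move=> wx; rewrite /point_measure (esumID [set x])// [LHS]addeC; congr (_ + _)%E.
  congr (esum _ _); apply/seteqP; split=> [y [[//|yx] /(_ yx)]//|y wy].
  by split; [left|move=> yx; apply: wx; rewrite -yx].
rewrite (_ : _ `&` _ = [set x]) ?esum_set1//.
by apply/seteqP; split => [y []//|y ->]; split => //; right.
Qed.

Lemma point_measure_del w x B : points w x ->
  point_measure w B = (point_measure (del_pt w x) B + \d_x B)%E :> \bar R.
Proof.
by move=> wx; rewrite -[in LHS](del_ptK wx) point_measure_add// => -[_]; apply.
Qed.

Lemma measurable_config w : measurable (w : set X).
Proof. exact/measurable_countable/countable_points. Qed.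

Lemma point_measureC0 w : point_measure w (~` w) = 0%E :> \bar R.
Proof. by rewrite -point_measureI setICr measure0. Qed.

(** The complement of w is negligible for the point measure of w. *)
Lemma integral_point_measure_eq w (D : set X) (f g : X -> \bar R) :
  measurable D -> measurable_fun D f -> measurable_fun D g ->
  (forall x, points w x -> D x -> f x = g x) ->
  (\int[point_measure w]_(x in D) f x = \int[point_measure w]_(x in D) g x)%E.
Proof.
move=> mD mf mg fg; apply: ae_eq_integral => //.
exists (~` w); split; [exact/measurableC/measurable_config|exact: point_measureC0|].
move=> x /= nfg wx; apply: nfg => Dx; exact: fg.
Qed.

End counting.

(** An infinite measure is sent to 0 by [fine], so the value is a natural number even
then; this makes Charlier polynomials of random
counts measurable. *)
Lemma fine_point_measure_nat d (R : realType) (X : borelMetricType d R)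
    (w : config X) (E : set X) : measurable E ->
  exists m : nat, fine (point_measure w E : \bar R) = m%:R.
Proof.
move=> mE; have [fE|iE] := pselect (finite_set (w `&` E)).
  by exists (npts w E); rewrite point_measure_npts.
exists 0%N; rewrite (_ : point_measure w E = +oo%E)//.
apply/eqyP => a a0.
have [m am] : exists m : nat, a <= m%:R.
  by exists (Num.truncn a).+1; apply/ltW/truncnS_gt.
have [B BwE mB] := infinite_set_fset m iE.
apply: (@le_trans _ _ (point_measure w [set` B])).
  have wB : w `&` [set` B] = [set` B] by apply: setIidr => x /BwE[].
  rewrite point_measure_npts; last by rewrite wB; exact: finite_fset.
  by rewrite lee_fin /npts wB set_fsetK (le_trans am)// ler_nat.
apply: le_measure; rewrite ?inE//; last by move=> x /BwE[].
exact/measurable_countable/finite_set_countable/finite_fset.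
Qed.

(** * Measurability of the operations on configurations *)

Section config_measurability.
Context {d} {R : realType} {X : borelMetricType d R}.
Hypothesis sX : sigma_compact X.

(** A point outside a locally finite set has a neighbourhood that meets the set in
finitely many points, which can be removed from it. *)
Lemma closed_config (w : config X) : closed (w : set X).
Proof.
move=> t clt; have [V Vt fV] := locally_finite_points w t.
apply: contrapT => wt.
have cF : closed (w `&` V).
  apply: compact_closed; first exact: metric_hausdorff.
  exact: finite_compact.
have nt : nbhs t (~` (w `&` V)).
  by apply: open_nbhs_nbhs; split; [exact: closed_openC|case].
by have [y [wy [Vy]]] := clt _ (filterI Vt nt); apply.
Qed.

Let U (n : nat) (q : X) : set X := (ball q n.+1%:R^-1)°.

(** For each radius, every compact set of an exhaustion is covered by finitely
many balls: the separability of X in the form needed for countable unions. *)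
Lemma exists_finite_nets : exists D : nat -> nat -> {fset X},
  forall n (x : X), exists m q, q \in D m n /\ U n q x.
Proof.
have [K [cK KT]] := sX.
have cov m n : exists D : {fset X}, K m `<=` \bigcup_(q in [set` D]) U n q.
  have := cK m; rewrite compact_cover => /(_ X setT (U n))[q _|x _|D _ KD].
  - exact: open_interior.
  - exists x => //; apply: nbhsx_ballx; by rewrite invr_gt0.
  - by exists D.
exists (fun m n => sval (cid (cov m n))) => // n x.
have [m _ Kmx] : (\bigcup_n K n) x by rewrite KT.
have := svalP (cid (cov m n)) _ Kmx => -[q /= qD Uq].
by exists m, q.
Qed.

Lemma measurable_point_measure (B : set X) : measurable B ->
  measurable_fun [set: config X] (fun w => point_measure w B : \bar R).
Proof.
move=> mB _ Y mY; apply: sub_sigma_algebra; exists B => //.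
by exists Y.
Qed.

Lemma measurable_fun_config d' (Z : measurableType d') (g : Z -> config X) :
  (forall B, measurable B -> measurable_fun [set: Z] (fun z => point_measure (g z) B : \bar R)) ->
  measurable_fun [set: Z] g.
Proof.
move=> mg; apply: (measurability (@config_generators d R X)) => //.
move=> _ [_ [B mB [Y mY <-]] <-].
have := mg B mB measurableT Y mY.
by rewrite !setTI.
Qed.

(** As w is closed, t belongs to w exactly when, at every scale, a ball of the net
around t contains a point of w; this involves countably many counting events. *)
Lemma measurable_mem_config : measurable [set p : config X * X | points p.1 p.2].
Proof.
have [D hD] := exists_finite_nets.
rewrite [X in measurable X](_ : _ = \bigcap_n \bigcup_m \bigcup_(q in [set` D m n])
    ([set w : config X | (1 <= (point_measure w (U n q) : \bar R))%E] `*` U n q)).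
  apply: bigcapT_measurable => n; apply: bigcupT_measurable => m.
  apply: fin_bigcup_measurable; first exact: finite_fset.
  move=> q _; apply: measurableX; last exact/measurable_open/open_interior.
  have mU : measurable (U n q) by exact/measurable_open/open_interior.
  rewrite -[X in measurable X]setTI.
  by apply: emeasurable_fun_c_infty => //; exact: measurable_point_measure.
apply/seteqP; split => [[w t] /= wt n _|[w t] /= h].
  have [m [q [qD Uqt]]] := hD n t; exists m => //; exists q => //; split => //=.
  rewrite -[w](del_ptK wt) point_measure_add; last by case=> _; apply.
  by rewrite diracE mem_set//; exact: leeDr.
apply: (@closed_config w t) => B /nbhs_ballP[e /= e0 teB].
have [n ne] : exists n, n.+1%:R^-1 < e / 2.
  have [//|n] := @ltr_add_invr R 0%R (e / 2) _; first by rewrite divr_gt0.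
  by rewrite add0r => ?; exists n.
have [m _ [q _ [/= wU Uqt]]] := h n I.
have [y [wy Uy]] : w `&` U n q !=set0.
  apply/set0P/eqP => wU0; move: wU.
  by rewrite -point_measureI wU0 measure0 lee_fin ler10.
exists y; split => //; apply: teB; rewrite [e]splitr; apply: (@ball_triangle _ _ q).
  by apply: (le_ball (ltW ne)); apply/ball_sym; exact: interior_subset.
by apply: (le_ball (ltW ne)); exact: interior_subset.
Qed.

Lemma measurable_fun_indic_mem (B : set X) : measurable B ->
  measurable_fun [set: config X * X]
    (fun p => (\1_([set p : config X * X | points p.1 p.2] `&` (setT `*` B)) p)%:E : \bar R).
Proof.
move=> mB; apply/measurable_EFinP/measurable_indic/measurableI; last exact: measurableX.
exact: measurable_mem_config.
Qed.

Lemma measurable_add_pt : measurable_fun [set: config X * X] (fun p => add_pt p.1 p.2).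
Proof.
apply: measurable_fun_config => B mB.
rewrite (_ : (fun _ => _) = (fun p : config X * X => ((point_measure p.1 B : \bar R) +
    (\1_(~` [set p : config X * X | points p.1 p.2] `&` (setT `*` B)) p)%:E)%E)).
  apply: emeasurable_funD.
    exact: (measurableT_comp (measurable_point_measure mB)).
  apply/measurable_EFinP/measurable_indic/measurableI; last exact: measurableX.
  by apply: measurableC; exact: measurable_mem_config.
apply/funext => -[w x] /=; rewrite indicE in_setI.
have [wx|wx] := pselect (points w x).
  by rewrite add_pt_id// memNset/= ?adde0// => /(_ wx).
by rewrite point_measure_add// mem_set//= diracE; congr (_ + (_ : bool)%:R%:E)%E;
  apply/idP/idP; rewrite !inE => // -[].
Qed.

Lemma measurable_del_pt : measurable_fun [set: config X * X] (fun p => del_pt p.1 p.2).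
Proof.
apply: measurable_fun_config => B mB.
rewrite (_ : (fun _ => _) = (fun p : config X * X => ((point_measure p.1 B : \bar R) -
    (\1_([set p : config X * X | points p.1 p.2] `&` (setT `*` B)) p)%:E)%E)).
  apply: emeasurable_funB; last exact: measurable_fun_indic_mem.
  exact: (measurableT_comp (measurable_point_measure mB)).
apply/funext => -[w x] /=; rewrite indicE in_setI.
have [wx|wx] := pselect (points w x).
  rewrite (point_measure_del _ wx) mem_set//= diracE.
  rewrite (_ : (_ \in _ `*` _) = (x \in B)) ?addeK//.
  by apply/idP/idP; rewrite !inE => // -[].
by rewrite del_pt_id// memNset//= sube0.
Qed.

End config_measurability.

(** Integrals against an s-finite kernel depend measurably on the parameter.  The point measure is one: split X into the disjoint
pieces [seqDU K n] of a compact exhaustion, and split again according to the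
number m of points in the piece, so that each part has total mass at most m. *)
Section point_measure_kernel.
Context {d} {R : realType} {X : borelMetricType d R}.
Context d' (Z : measurableType d') (g : Z -> config X).
Hypothesis mg : measurable_fun [set: Z] g.
Variables (K : (set X)^nat).
Hypotheses (cK : forall n, compact (K n)) (KT : \bigcup_n K n = [set: X]).

Let mseqDU n : measurable (seqDU K n).
Proof.
by apply: measurableD; [|apply: bigsetU_measurable => i _]; exact: measurable_compact.
Qed.

Definition point_measure_piece n m (z : Z) : {measure set X -> \bar R} :=
  if (point_measure (g z) (seqDU K n) == m%:R%:E :> \bar R)
  then [the {measure set X -> \bar R} of mrestr (point_measure (g z)) (mseqDU n)]
  else [the {measure set X -> \bar R} of mzero].

Let point_measure_pieceE n m z (V : set X) : point_measure_piece n m z V =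
  if (point_measure (g z) (seqDU K n) == m%:R%:E :> \bar R)
  then point_measure (g z) (V `&` seqDU K n) else 0%E.
Proof. by rewrite /point_measure_piece; case: ifP. Qed.

Let measurable_piece n m V : measurable V ->
  measurable_fun [set: Z] (point_measure_piece n m ^~ V).
Proof.
move=> mV; under eq_fun do rewrite point_measure_pieceE.
have mp B : measurable B -> measurable_fun [set: Z] (fun z => point_measure (g z) B : \bar R).
  by move=> mB; exact: (measurableT_comp (measurable_point_measure mB)).
apply: measurable_fun_ifT => //; last by apply: mp; exact: measurableI.
apply: (measurable_fun_bool true) => //.
rewrite setTI (_ : _ @^-1` _ =
    (fun z => point_measure (g z) (seqDU K n) : \bar R) @^-1` [set m%:R%:E]).
  by rewrite -[X in measurable X]setTI; apply: mp.
by apply/seteqP; split => z /= /eqP.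
Qed.

HB.instance Definition _ n m :=
  isKernel.Build _ _ _ _ _ (point_measure_piece n m) (@measurable_piece n m).

Let piece_uub n m : measure_fam_uub (point_measure_piece n m).
Proof.
exists m.+1%:R => z; rewrite point_measure_pieceE; case: ifPn => [/eqP|_]; last first.
  by rewrite lte_fin ltr0n.
by rewrite setTI => ->; rewrite lte_fin ltr_nat.
Qed.

HB.instance Definition _ n m := Kernel_isFinite.Build _ _ _ _ _
  (point_measure_piece n m) (@piece_uub n m).

Let slice n : R.-sfker Z ~> X := kseries (fun m => point_measure_piece n m).

Let sliceE n z V : measurable V -> slice n z V = point_measure (g z) (V `&` seqDU K n).
Proof.
move=> mV; rewrite /slice /kseries/= /mseries /= nneseries_esumT//.
have := point_measure_compact (g z) (@cK n) (@subset_seqDU _ K n).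
set k := npts _ _ => gk.
transitivity (\esum_(m in [set k]) point_measure (g z) (V `&` seqDU K n)).
  rewrite [RHS]esum_mkcond; apply: eq_esum => m _; rewrite point_measure_pieceE gk.
  rewrite eqe eqr_nat (_ : (m \in [set k]) = (k == m))//.
  by apply/idP/idP => [/set_mem ->//|/eqP ->]; exact: mem_set.
by rewrite esum_set1.
Qed.

Lemma point_measure_sfkernel : exists k : R.-sfker Z ~> X,
  forall z V, measurable V -> k z V = point_measure (g z) V.
Proof.
exists (kseries slice) => z V mV; rewrite /kseries/= /mseries/=.
under eq_eseriesr do rewrite sliceE//.
rewrite -measure_semi_bigcup.
- by rewrite -setI_bigcupr -seqDU_bigcup_eq KT setIT.
- by move=> i; exact: measurableI.
- exact/trivIset_setIl/trivIset_seqDU.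
- by apply: bigcup_measurable => i _; exact: measurableI.
Qed.

End point_measure_kernel.

Lemma measurable_integral_point_measure d (R : realType) (X : borelMetricType d R)
    d' (Z : measurableType d') (g : Z -> config X) (D : set X) (f : Z * X -> \bar R) :
  sigma_compact X -> measurable_fun [set: Z] g -> measurable D ->
  (forall p, 0 <= f p)%E -> measurable_fun [set: Z * X] f ->
  measurable_fun [set: Z] (fun z => \int[point_measure (g z)]_(x in D) f (z, x))%E.
Proof.
move=> [K [cK KT]] mg mD f0 mf.
have [k kE] := point_measure_sfkernel mg cK KT.
pose fD (p : Z * X) := (f p * (\1_(setT `*` D) p)%:E)%E.
rewrite (_ : (fun _ => _) = fun z => \int[k z]_x fD (z, x))%E.
  apply: measurable_fun_integral_sfinite_kernel.
    by move=> p; rewrite mule_ge0// lee_fin.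
  apply: emeasurable_funM => //.
  by apply/measurable_EFinP; apply: measurable_indic; exact: measurableX.
apply/funext => z; rewrite [LHS]integral_mkcond.
rewrite (eq_measure_integral (k z)); last by move=> A mA _; rewrite kE.
apply: eq_integral => x _; rewrite /fD patchE indicE in_setX in_setT/=.
by case: ifP; rewrite ?mule1 ?mule0.
Qed.

(** * Mixtures of measures *)

Section mixture.
Local Open Scope ereal_scope.
Context d d' (W : measurableType d) (T : measurableType d') (R : realType).
Variables (mu : {measure set W -> \bar R}) (nu : W -> {measure set T -> \bar R}).

(** The law of t when w is drawn from mu and then t from nu w. *)
Definition mixture (E : set T) : \bar R := \int[mu]_w nu w E.

Hypothesis mnu : forall E, measurable E -> measurable_fun [set: W] (nu ^~ E).

Let mixture0 : mixture set0 = 0.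
Proof. by rewrite /mixture integral0_eq// => w _; rewrite measure0. Qed.

Let mixture_ge0 E : 0 <= mixture E. Proof. exact: integral_ge0. Qed.

Let mixture_sigma_additive : semi_sigma_additive mixture.
Proof.
move=> F mF tF mUF; apply: cvg_toP; first exact: is_cvg_ereal_nneg_natsum.
rewrite [RHS](_ : _ = \int[mu]_w (\sum_(n <oo) nu w (F n))).
  by rewrite integral_nneseries// => n; exact: mnu.
by apply: eq_integral => w _; rewrite measure_semi_bigcup.
Qed.

Definition mmixture : {measure set T -> \bar R} :=
  HB.pack mixture (isMeasure.Build _ _ _ mixture mixture0 mixture_ge0 mixture_sigma_additive).

Import HBNNSimple.

Let measurable_int (f : T -> \bar R) : (forall t, 0 <= f t) -> measurable_fun setT f ->
  measurable_fun [set: W] (fun w => \int[nu w]_t f t).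
Proof. by move=> f0 mf; exact: measurable_fun_integral_kernel. Qed.

Let integral_mixture_nnsfun (f : {nnsfun T >-> R}) :
  \int[mmixture]_t (f t)%:E = \int[mu]_w \int[nu w]_t (f t)%:E.
Proof.
have fE (m : {measure set T -> \bar R}) :
    \int[m]_t (f t)%:E = \sum_(r \in range f) r%:E * m (f @^-1` [set r]).
  by rewrite integralT_nnsfun sintegralE.
rewrite fE; under eq_integral do rewrite fE.
rewrite ge0_integral_fsum//.
- apply: eq_fsbigr => r; rewrite inE => -[t _ <-].
  by rewrite ge0_integralZl//; [exact: mnu|rewrite lee_fin].
- by move=> r; apply: measurable_funeM; exact: mnu.
- move=> r w _; have [r0|r0] := leP 0%R r; first by rewrite mule_ge0.
  by rewrite preimage_nnfun0// measure0 mule0.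
Qed.

(** Both sides are linear and commute with increasing limits, so simple functions
suffice. *)
Lemma integral_mixture (f : T -> \bar R) :
  (forall t, 0 <= f t) -> measurable_fun setT f ->
  \int[mmixture]_t f t = \int[mu]_w \int[nu w]_t f t.
Proof.
move=> f0 mf; pose g := nnsfun_approx measurableT mf.
have gf (m : {measure set T -> \bar R}) :
    \int[m]_t f t = lim (\int[m]_t (g n t)%:E @[n --> \oo]).
  rewrite -monotone_convergence//.
  - by apply: eq_integral => t _; apply/esym/cvg_lim => //; exact: cvg_nnsfun_approx.
  - by move=> n; exact/measurable_EFinP.
  - by move=> n t _; rewrite lee_fin.
  - by move=> t _ a b ab; rewrite lee_fin; exact/lefP/nd_nnsfun_approx.
rewrite gf; under eq_fun do rewrite integral_mixture_nnsfun.
under [RHS]eq_integral do rewrite gf.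
rewrite monotone_convergence//.
- by move=> n; apply: measurable_int => //; [move=> t; rewrite lee_fin|exact/measurable_EFinP].
- by move=> n w _; apply: integral_ge0 => t _; rewrite lee_fin.
- move=> w _ a b ab; apply: ge0_le_integral => //.
  + by move=> t _; rewrite lee_fin.
  + exact/measurable_EFinP.
  + exact/measurable_EFinP.
  + by move=> t _; rewrite lee_fin; exact/lefP/nd_nnsfun_approx.
Qed.

End mixture.

(** * The Mecke formula *)

Definition mpushforward d d' (T1 : measurableType d) (T2 : measurableType d')
    (R : realFieldType) (m : {measure set T1 -> \bar R}) (f : T1 -> T2)
    (mf : measurable_fun [set: T1] f) : {measure set T2 -> \bar R} :=
  measure_function_pushforward__canonical__measure_function_Measure m mf.

Section mecke.
Local Open Scope ereal_scope.
Context (d : measure_display) (R : realType) (X : borelMetricType d R).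
Variables (sigma : {sigma_finite_measure set X -> \bar R}).
Variables (P : probability (config X) R).
Hypothesis sX : sigma_compact X.

Let madd (x : X) : measurable_fun [set: config X] (fun w => (add_pt w x, x)).
Proof.
apply: measurable_fun_pair => //.
exact: (measurableT_comp (measurable_add_pt sX) (pair2_measurable x)).
Qed.

Let madd2 : measurable_fun [set: config X * X] (fun p => (add_pt p.1 p.2, p.2)).
Proof. by apply: measurable_fun_pair => //; exact: measurable_add_pt. Qed.

Let nu1 (w : config X) := mpushforward (point_measure w) (pair1_measurable (T2 := X) w).
Let nu2 (x : X) := mpushforward P (madd x).

Let mnu1 E : measurable E -> measurable_fun [set: config X] (nu1 ^~ E).
Proof.
move=> mE; rewrite (_ : _ ^~ _ = fun w => \int[point_measure w]_(x in setT) (\1_E (w, x))%:E).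
  apply: (@measurable_integral_point_measure _ _ _ _ _ id setT (fun p => (\1_E p)%:E)) => //.
  exact/measurable_EFinP/measurable_indic.
apply/funext => w.
have mEw : measurable (pair w @^-1` E).
  by rewrite -[X in measurable X]setTI; exact: pair1_measurable.
transitivity (point_measure w (pair w @^-1` E `&` setT)); first by rewrite setIT.
by rewrite -(integral_indic _ measurableT mEw).
Qed.

Let mnu2 E : measurable E -> measurable_fun [set: X] (nu2 ^~ E).
Proof.
move=> mE.
have mE' : measurable ((fun p : config X * X => (add_pt p.1 p.2, p.2)) @^-1` E).
  by rewrite -[X in measurable X]setTI; exact: madd2.
have := measurable_fun_ysection P mE'.
congr measurable_fun; apply/funext => x; congr (P _).
by apply/seteqP; split => w; rewrite /ysection/= inE.
Qed.

(** The two measures that the Mecke formula identifies: [campbell] attaches to a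
random configuration each of its points, [insertion] inserts into a random
configuration a point chosen from sigma. *)
Definition campbell : {measure set (config X * X) -> \bar R} := mmixture P mnu1.
Definition insertion : {measure set (config X * X) -> \bar R} := mmixture sigma mnu2.

Lemma campbellE E : campbell E = \int[P]_w point_measure w [set x | E (w, x)].
Proof. by []. Qed.

Lemma insertionE E : insertion E = \int[sigma]_x P [set w | E (add_pt w x, x)].
Proof. by []. Qed.

Lemma integral_campbell (f : config X * X -> \bar R) :
  (forall p, 0 <= f p) -> measurable_fun setT f ->
  \int[campbell]_p f p = \int[P]_w \int[point_measure w]_x f (w, x).
Proof.
move=> f0 mf; rewrite integral_mixture//; apply: eq_integral => w _.
by rewrite ge0_integral_pushforward.
Qed.

Lemma integral_insertion (f : config X * X -> \bar R) :
  (forall p, 0 <= f p) -> measurable_fun setT f ->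
  \int[insertion]_p f p = \int[sigma]_x \int[P]_w f (add_pt w x, x).
Proof.
move=> f0 mf; rewrite integral_mixture//; apply: eq_integral => x _.
by rewrite ge0_integral_pushforward.
Qed.

End mecke.

(** Countable additivity over the fibers of a countably valued map. *)
Lemma measure_eq_fibers d (T : measurableType d) (R : realType)
    (m1 m2 : {measure set T -> \bar R}) (I : countType) (c : T -> I) (Q : pred I) :
  (forall i, measurable (c @^-1` [set i])) ->
  (forall i, Q i -> m1 (c @^-1` [set i]) = m2 (c @^-1` [set i])) ->
  m1 (c @^-1` [set i | Q i]) = m2 (c @^-1` [set i | Q i]).
Proof.
move=> mc h.
pose F n := if choice.unpickle n is Some i then if Q i && (choice.pickle i == n) then c @^-1` [set i] else set0 else set0.
have cE : c @^-1` [set i | Q i] = \bigcup_n F n.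
  apply/seteqP; split => [t /= Qt|t [n _]].
    by exists (choice.pickle (c t)) => //; rewrite /F pickleK Qt eqxx.
  by rewrite /F; case: (choice.unpickle _) => // i; case: ifP => // /andP[Qi _] /= ->.
have mF n : measurable (F n).
  by rewrite /F; case: (choice.unpickle _) => [i|//]; case: ifP.
have tF : trivIset setT F.
  apply/trivIsetP => a b _ _; apply: contra_neqP => /eqP/set0P[t []].
  rewrite /F; case: (choice.unpickle _) => // i; case: ifP => // /andP[_ /eqP <-] /= <-.
  by case: (choice.unpickle _) => // j; case: ifP => // /andP[_ /eqP <-] /= <-.
rewrite cE !measure_semi_bigcup//; try exact: bigcup_measurable.
apply: eq_eseriesr => n _; rewrite /F; case: (choice.unpickle _) => [i|]; last by rewrite !measure0.
by case: ifP => [/andP[Qi _]|_]; [exact: h|rewrite !measure0].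
Qed.

(** A compact set L is cut into finitely many labelled atoms [E J]; [c w] records the
number of points of w in each of them. *)
Section mecke_atoms.
Local Open Scope ereal_scope.
Context (d : measure_display) (R : realType) (X : borelMetricType d R).
Variables (sigma : {sigma_finite_measure set X -> \bar R}).
Variables (P : probability (config X) R).
Hypothesis sX : sigma_compact X.
Hypothesis sigma0 : forall x : X, sigma [set x] = 0.
Hypothesis sigma_compact_lty : forall L : set X, compact L -> sigma L < +oo.
Hypothesis poissonP : is_poisson sigma P.

(** The Poisson law of parameter sigma {x} = 0 is concentrated at 0. *)
Lemma fixed_point0 (x : X) : P [set w : config X | points w x] = 0.
Proof.
have m0 : measurable [set w : config X | point_measure w [set x] = 0%:R%:E :> \bar R].
  rewrite -[X in measurable X]setTI.
  exact: (measurable_point_measure (measurable_point x) measurableT (emeasurable_set1 _)).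
have := poissonP.1 [set x] 0%N (measurable_point x).
rewrite sigma0 ltry => /(_ isT) /=; rewrite oppr0 expR0 expr0 fact0 divr1 mulr1 => P1.
rewrite (_ : [set w | _] = ~` [set w : config X | point_measure w [set x] = 0%:R%:E :> \bar R]).
  by rewrite probability_setC// P1 subee.
apply/seteqP; split => [w /= wx|w /= h].
  rewrite (point_measure_del _ wx) diracE mem_set// => /eqP.
  by rewrite padde_eq0//= => /andP[_ /eqP[]/eqP]; rewrite oner_eq0.
apply: contrapT => wx; apply: h; rewrite -point_measureI (_ : _ `&` _ = set0) ?measure0//.
by apply/seteqP; split => y //= [wy yx]; apply: wx; rewrite -yx.
Qed.

Variables (L : set X) (T : finType) (sig : X -> T).
Hypothesis cL : compact L.
Let E (J : T) := [set x | L x /\ sig x = J].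
Hypothesis mE : forall J, measurable (E J).

Let EL J : E J `<=` L. Proof. by move=> x []. Qed.

Let sE J : sigma (E J) < +oo.
Proof.
apply: le_lt_trans (sigma_compact_lty cL).
by apply: le_measure; rewrite ?inE//; exact: measurable_compact.
Qed.

Let tE : trivIset setT E.
Proof.
by apply/trivIsetP => i j _ _; apply: contra_neqP => /eqP/set0P[x [[_ <-] [_ <-]]].
Qed.

Let c (w : config X) : {ffun T -> nat} := [ffun J => npts w (E J)].

Let pmE w J : point_measure w (E J) = (npts w (E J))%:R%:E :> \bar R.
Proof. exact: point_measure_compact cL (@EL J). Qed.

Let cE (l : {ffun T -> nat}) : c @^-1` [set l] =
  \bigcap_(i : 'I_#|T|) [set w : config X | point_measure w (E (enum_val i)) = (l (enum_val i))%:R%:E :> \bar R].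
Proof.
apply/seteqP; split => [w /= <- i _ /=|w /= h].
  by rewrite pmE ffunE.
apply/ffunP => J; rewrite ffunE; apply/eqP.
have /eqP := h (enum_rank J) I; rewrite /= enum_rankK pmE eqe eqr_nat.
exact.
Qed.

Let mc l : measurable (c @^-1` [set l]).
Proof.
rewrite cE; apply: fin_bigcap_measurable; first exact: finite_finset.
move=> i _; rewrite -[X in measurable X]setTI.
  exact: (measurable_point_measure (mE _) measurableT (emeasurable_set1 _)).
Qed.

Let pmf (J : T) (k : nat) : R :=
  (expR (- fine (sigma (E J))) * fine (sigma (E J)) ^+ k / k`!%:R)%R.

Lemma prob_counts (l : {ffun T -> nat}) :
  P (c @^-1` [set l]) = (\prod_J pmf J (l J))%:E.
Proof.
rewrite cE (poissonP.2 _ (fun i => E (enum_val i)) (fun i => l (enum_val i)))//; last first.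
  apply/trivIsetP => i j _ _ ij; move/trivIsetP : tE; apply => //.
  by apply: contra ij => /eqP/enum_val_inj ->.
rewrite [in RHS](reindex _ (onW_bij _ (@enum_val_bij T)))/= -prodEFin.
by apply: eq_bigr => i _; rewrite poissonP.1.
Qed.

(** The counts before a point is inserted in the atom J. *)
Let dec (l : {ffun T -> nat}) J : {ffun T -> nat} := [ffun J' => l J' - (J' == J)]%N.

(** The recurrence of the Poisson weights, which is the analytic content of the
Mecke formula. *)
Lemma pmfS J k : (k.+1%:R * pmf J k.+1 = fine (sigma (E J)) * pmf J k)%R.
Proof.
rewrite /pmf factS natrM exprS; field.
by rewrite ?natr1 ?nat1r !pnatr_eq0 -!lt0n fact_gt0.
Qed.

Lemma campbell_atom l J :
  campbell P sX (c @^-1` [set l] `*` E J) = (l J)%:R%:E * P (c @^-1` [set l]).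
Proof.
rewrite campbellE -[in RHS](setIT (c @^-1` [set l])) -(integral_indic P measurableT (mc l)).
rewrite -ge0_integralZl//; last exact/measurable_EFinP/measurable_indic.
apply: eq_integral => w _; rewrite indicE.
have [wl|wl] := boolP (w \in _).
  rewrite mule1 (_ : [set x | _] = E J) ?pmE.
    by move: wl; rewrite inE /= => <-; rewrite ffunE.
  by move: wl; rewrite inE => wl; apply/seteqP; split => [x []//|x Ex]; split.
rewrite mule0 (_ : [set x | _] = set0) ?measure0//.
by apply/seteqP; split => // x [/= wl']; move/negP: wl; rewrite inE.
Qed.

Let addcE w x J K : ~ points w x -> E J x ->
  npts (add_pt w x) (E K) = (npts w (E K) + (K == J))%N.
Proof.
move=> wx [Lx <-]; apply/eqP; rewrite -(eqr_nat R) -eqe -pmE point_measure_add// pmE.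
rewrite diracE natrD EFinD (_ : (x \in E K) = (K == sig x))//.
by apply/idP/eqP => [/set_mem[_ ->]//|->]; apply/mem_set.
Qed.

(** Inserting x raises the count of its own atom by one, unless x was already
there, which has probability 0. *)
Let prob_add l J x : E J x -> P [set w | c (add_pt w x) = l] =
  if (0 < l J)%N then P (c @^-1` [set dec l J]) else 0.
Proof.
move=> Ex.
have mS : measurable [set w | c (add_pt w x) = l].
  rewrite -[X in measurable X]setTI.
  exact: (measurableT_comp (measurable_add_pt sX) (pair2_measurable x) _ (mc l)).
have mx : measurable [set w : config X | points w x].
  rewrite -[X in measurable X]setTI.
  exact: (pair2_measurable x measurableT (measurable_mem_config sX)).
have PD A : measurable A -> P A = P (A `\` [set w : config X | points w x]).
  move=> mA; rewrite measureD//; last by apply: (le_lt_trans (probability_le1 _ _)); rewrite ?ltry.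
  rewrite [X in _ - X](_ : _ = 0) ?sube0//.
  by apply: subset_measure0 (fixed_point0 x) => //; exact: measurableI.
case: ifPn => [l0|]; last first.
  rewrite -eqn0Ngt => /eqP l0; rewrite PD// (_ : _ `\` _ = set0) ?measure0//.
  apply/seteqP; split => // w [/= cl wx]; move/ffunP: cl => /(_ J).
  by rewrite ffunE (@addcE _ _ J)// eqxx addn1 l0.
rewrite PD// [RHS]PD//; congr (P _); apply/seteqP; split => w [/= cl wx]; split => //.
  apply/ffunP => K; rewrite !ffunE -cl ffunE (@addcE _ _ J)//.
  by rewrite addnK.
apply/ffunP => K; rewrite ffunE (@addcE _ _ J)//; move/ffunP: cl => /(_ K).
rewrite !ffunE => ->; apply: subnK.
by case: eqP => // ->.
Qed.

Lemma insertion_atom l J : insertion sigma P sX (c @^-1` [set l] `*` E J) =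
  sigma (E J) * (if (0 < l J)%N then P (c @^-1` [set dec l J]) else 0).
Proof.
rewrite insertionE [RHS]muleC -[in RHS](setIT (E J)) -(integral_indic sigma measurableT (mE J)).
rewrite -ge0_integralZl//; [|exact/measurable_EFinP/measurable_indic|by case: ifP].
apply: eq_integral => x _; rewrite indicE.
have [xE|xE] := boolP (x \in _).
  move/set_mem : xE => xE; rewrite mule1 -(prob_add _ xE); congr (P _).
  by apply/seteqP; split => [w []//|w wl]; split.
rewrite mule0 (_ : [set x | _] = set0) ?measure0//.
by apply/seteqP; split => // w [/= _]; move/negP: xE; rewrite inE.
Qed.

Lemma mecke_atom l J : campbell P sX (c @^-1` [set l] `*` E J) =
  insertion sigma P sX (c @^-1` [set l] `*` E J).
Proof.
rewrite campbell_atom insertion_atom; case: (posnP (l J)) => [->|l0].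
  by rewrite mul0e mule0.
rewrite -(@fineK _ (sigma (E J))) ?ge0_fin_numE// !prob_counts -!EFinM; congr _%:E.
rewrite (bigD1 J)//= [in RHS](bigD1 J)//= !mulrA; congr (_ * _)%R; last first.
  by apply: eq_bigr => K /negPf KJ; rewrite ffunE KJ subn0.
by rewrite ffunE eqxx subn1; have := pmfS J (l J).-1; rewrite prednK// /pmf !mulrA.
Qed.

(** Points outside L are sent to [None], which the event excludes; the remaining
fibers are products of a counting event and an atom. *)
Lemma mecke_fibers (Q : pred ({ffun T -> nat} * T)) :
  campbell P sX [set p | L p.2 /\ Q (c p.1, sig p.2)] =
  insertion sigma P sX [set p | L p.2 /\ Q (c p.1, sig p.2)].
Proof.
pose g (p : config X * X) := if `[< L p.2 >] then Some (c p.1, sig p.2) else None.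
pose Q' (o : option ({ffun T -> nat} * T)) := if o is Some i then Q i else false.
have gE : g @^-1` [set o | Q' o] =
    [set p | L p.2 /\ Q (c p.1, sig p.2)].
  by apply/seteqP; split => p; rewrite /g/=; case: asboolP => // Lp; try by case.
have gS l J : g @^-1` [set Some (l, J)] = c @^-1` [set l] `*` E J.
  apply/seteqP; split => p; rewrite /g/=; case: asboolP => // Lp.
  - by case=> <- <-.
  - by case=> /= <- [_ <-].
  - by case=> _ [].
rewrite -gE.
apply: (@measure_eq_fibers _ _ _ (campbell P sX) (insertion sigma P sX) _ g Q')
  => [[[l J]|]|[[l J] _|//]].
- by rewrite gS; exact: measurableX.
- rewrite (_ : _ @^-1` _ = setT `*` ~` L).
    by apply: measurableX => //; exact/measurableC/measurable_compact.
  by apply/seteqP; split => p; rewrite /g/=; case: asboolP => // Lp [].  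
- by rewrite gS; exact: mecke_atom.
Qed.

End mecke_atoms.

Section counting_events.
Context (d : measure_display) (R : realType) (X : borelMetricType d R).
Hypothesis sX : sigma_compact X.

(** All counts are taken inside one compact set, hence finite.  Keeping the sets
[B i] arbitrary instead of disjoint is what makes the class stable under
intersection. *)
Definition counting_events : set (set (config X)) :=
  [set F | exists (I : finType) (B : I -> set X) (k : I -> nat) (L : set X),
    [/\ compact L, (forall i, measurable (B i)), (forall i, B i `<=` L) &
        F = [set w | forall i, npts w (B i) = k i]]].

Lemma counting_events_setI : setI_closed counting_events.
Proof.
move=> _ _ [I [B [k [L [cL mB BL ->]]]]] [I' [B' [k' [L' [cL' mB' BL' ->]]]]].
exists (I + I')%type, (fun i => match i with inl i => B i | inr i => B' i end).
exists (fun i => match i with inl i => k i | inr i => k' i end), (L `|` L').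
split; [exact: (compactU cL cL')|by case=> i; [exact: mB|exact: mB']|by case=> i x Bx; [left; exact: BL Bx|right; exact: BL' Bx]|].
apply/seteqP; split => [w [h h'] [i|i]|w h]; [exact: h|exact: h'|].
by split => i; [exact: (h (inl i))|exact: (h (inr i))].
Qed.

Lemma counting_eventsT : counting_events setT.
Proof.
exists void, (fun=> set0), (fun=> 0%N), set0; split => //; first exact: compact0.
by apply/seteqP; split => // w _ [].
Qed.

Lemma measurable_counting_events : counting_events `<=` measurable.
Proof.
move=> _ [I [B [k [L [cL mB BL ->]]]]].
rewrite (_ : [set w | _] = \bigcap_i [set w : config X | point_measure w (B i) = (k i)%:R%:E :> \bar R]).
  apply: fin_bigcap_measurable; first exact: finite_finset.
  move=> i _; rewrite -[X in measurable X]setTI.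
  exact: (measurable_point_measure (mB i) measurableT (emeasurable_set1 _)).
apply/seteqP; split => [w h i _ /=|w h i]; first by rewrite (point_measure_compact _ cL)// h.
by have := h i Logic.I; rewrite /= (point_measure_compact _ cL (BL i)) => -[/eqP]; rewrite eqr_nat => /eqP.
Qed.

(** A count in an arbitrary Borel set is the sum of the counts in its intersections
with the pieces of a compact exhaustion. *)
Lemma measurable_configE :
  (@measurable _ (config X) : set (set (config X))) = <<s counting_events >>.
Proof.
apply/seteqP; split; last first.
  by apply: smallest_sub; [exact: sigma_algebra_measurable|exact: measurable_counting_events].
apply: smallest_sub; first exact: smallest_sigma_algebra.
move=> _ [B mB [Y mY <-]].
suff mpB : measurable_fun [set: g_sigma_algebraType counting_events]
    (fun w : config X => point_measure w B : \bar R).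
  exact: (mpB measurableT Y mY).
have [K [cK KT]] := sX.
have mD n : measurable (seqDU K n).
  apply: measurableD; first exact: (measurable_compact (@cK n)).
  by apply: bigsetU_measurable => i _; exact: (measurable_compact (@cK i)).
rewrite (_ : (fun _ => _) = (fun w => \sum_(n <oo) (point_measure w (B `&` seqDU K n) : \bar R))%E); last first.
  apply/funext => w; rewrite -measure_semi_bigcup.
  - by rewrite -setI_bigcupr -seqDU_bigcup_eq KT setIT.
  - by move=> i; exact: measurableI.
  - exact/trivIset_setIl/trivIset_seqDU.
  - by apply: bigcup_measurable => i _; exact: measurableI.
apply: ge0_emeasurable_sum => // n _ _ Z mZ.
pose G (m : nat) := [set w : config X | npts w (B `&` seqDU K n) = m].
rewrite setTI (_ : _ @^-1` _ = \bigcup_(m in [set m : nat | Z m%:R%:E]) G m).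
  apply: bigcup_measurable => m _; apply: sub_sigma_algebra.
  exists unit, (fun=> B `&` seqDU K n), (fun=> m), (K n); split => //.
  - by move=> _; exact: measurableI.
  - by move=> _ x [_ xD]; exact: subset_seqDU xD.
  - by apply/seteqP; split => w h; [move=> _|apply: (h tt)].
have pE w : point_measure w (B `&` seqDU K n) = (npts w (B `&` seqDU K n))%:R%:E :> \bar R.
  by apply: (point_measure_compact _ (@cK n)) => x [_ xD]; exact: subset_seqDU xD.
apply/seteqP; split => [w /= Zw|w [m /= Zm Gm]]; last by rewrite /= pE Gm.
by exists (npts w (B `&` seqDU K n)) => //=; rewrite -pE.
Qed.

End counting_events.

Section mecke_formula.
Local Open Scope ereal_scope.
Context (d : measure_display) (R : realType) (X : borelMetricType d R).
Variables (sigma : {sigma_finite_measure set X -> \bar R}).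
Variables (P : probability (config X) R).
Hypothesis sX : sigma_compact X.
Hypothesis sigma0 : forall x : X, sigma [set x] = 0.
Hypothesis sigma_compact_lty : forall L : set X, compact L -> sigma L < +oo.
Hypothesis poissonP : is_poisson sigma P.

(** The labels are the membership patterns with respect to the sets [A i] of the
counting event and to B: counts in [A i] are sums of counts in atoms. *)
Let mecke_event F B L : counting_events F -> measurable B -> B `<=` L -> compact L ->
  campbell P sX (F `*` B) = insertion sigma P sX (F `*` B).
Proof.
move=> [T [A [k [L' [cL' mA AL' ->]]]]] mB BL cL.
pose L2 := L `|` L'; have cL2 : compact L2 by exact: (compactU cL cL').
(* [None] stands for the set B in which the attached point is required to lie. *)
pose S (o : option T) := if o is Some i then A i else B.
have mS o : measurable (S o) by case: o => [i|]; [exact: mA|].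
have SL2 o : S o `<=` L2 by case: o => [i|] x Sx; [right; exact: AL' Sx|left; exact: BL].
pose LT : finType := {ffun option T -> bool}.
pose sig x : LT := [ffun o => `[< S o x >]].
pose E (J : LT) := [set x | L2 x /\ sig x = J].
have mE J : measurable (E J).
  rewrite (_ : E J = L2 `&` \bigcap_o (if J o then S o else ~` S o)).
    apply: measurableI; first exact: measurable_compact.
    apply: fin_bigcap_measurable; first exact: finite_finset.
    by move=> o _; case: ifP => // _; exact: measurableC.
  apply/seteqP; split => [x [L2x <-]|x [L2x h]]; split => //.
    by move=> o _; rewrite ffunE; case: asboolP.
  apply/ffunP => o; rewrite ffunE; have := h o Logic.I.
  by case: (J o) => So; [exact/asboolP|apply/negbTE/asboolPn].
have nptsS w o : npts w (S o) = (\sum_(J : LT | J o) npts w (E J))%N.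
  apply/eqP; rewrite -(eqr_nat R) -eqe -(point_measure_compact _ cL2 (SL2 o)).
  rewrite (_ : S o = \bigcup_(J in [set` seq.filter (fun J : LT => J o) (index_enum LT)]) E J).
    rewrite measure_fin_bigcup//; last first.
      apply/trivIsetP => i j _ _; apply: contra_neqP => /eqP/set0P[x [[_ <-] [_ <-]]]//.
    rewrite -fsbig_seq/=; last by rewrite filter_uniq// index_enum_uniq.
    rewrite big_filter natr_sum -sumEFin; apply/eqP; apply: eq_bigr => J _.
    by apply: (point_measure_compact _ cL2) => x [].
  apply/seteqP; split => [x Sx|x [J /=]].
    exists (sig x); last by split=> //; exact: SL2 Sx.
    by rewrite /= mem_filter mem_index_enum ffunE andbT; exact/asboolP.
  by rewrite mem_filter => /andP[Jo _] [_ sJ]; move: Jo; rewrite -sJ ffunE => /asboolP.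
pose Q (p : {ffun LT -> nat} * LT) :=
  [forall i, (\sum_(J : LT | J (Some i)) p.1 J)%N == k i] && p.2 None.
have := mecke_fibers sX sigma0 sigma_compact_lty poissonP cL2 mE Q.
rewrite (_ : [set p | _] = [set w | forall i, npts w (A i) = k i] `*` B)//.
apply/seteqP; split => [[w x] [/= L2x /andP[/forallP h]]|[w x] [/= h Bx]].
  rewrite ffunE => /asboolP Bx; split=> // i; have /eqP := h i.
  move=> <-; rewrite [LHS](nptsS w (Some i)).
  by apply: eq_bigr => J _; rewrite ffunE.
split; first exact: (SL2 None).
apply/andP; split; last by rewrite ffunE; exact/asboolP.
apply/forallP => i; rewrite -h; apply/eqP; rewrite (nptsS w (Some i)).
by apply: eq_bigr => J _; rewrite ffunE.
Qed.

Let insertion_strip B : measurable B -> insertion sigma P sX (setT `*` B) = sigma B.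
Proof.
move=> mB; rewrite insertionE -[in RHS](setIT B) -(integral_indic sigma measurableT mB).
apply: eq_integral => x _; rewrite indicE.
have [xB|xB] := boolP (x \in B).
  rewrite (_ : [set w | _] = setT) ?probability_setT//.
  by apply/seteqP; split => // w _; split => //=; exact: set_mem.
rewrite (_ : [set w | _] = set0) ?measure0//.
by apply/seteqP; split => // w [_ /= Bx]; move/negP: xB; rewrite inE.
Qed.

(** Uniqueness of a finite measure on configurations given on counting events. *)
Let mecke_rectangle F B L : measurable F -> measurable B -> B `<=` L -> compact L ->
  campbell P sX (F `*` B) = insertion sigma P sX (F `*` B).
Proof.
move=> mF mB BL cL.
have mTB : measurable ([set: config X] `*` B) by exact: measurableX.
pose m1 := mpushforward (mrestr (campbell P sX) mTB) measurable_fst.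
pose m2 := mpushforward (mrestr (insertion sigma P sX) mTB) measurable_fst.
have stripE G : fst @^-1` G `&` ([set: config X] `*` B) = G `*` B.
  by apply/seteqP; split => [[w x] [/= Gw []]|[w x] [/= Gw Bx]].
suff : m1 F = m2 F by rewrite /m1 /m2 /= /pushforward/= /mrestr stripE.
have m12 G : counting_events G -> m1 G = m2 G.
  move=> cG; rewrite /m1 /m2 /= /pushforward/= /mrestr stripE.
  exact: mecke_event cG mB BL cL.
apply: (measure_unique (@counting_events d R X) (fun=> setT)) => //.
- exact: measurable_configE.
- exact: counting_events_setI.
- by move=> _; exact: counting_eventsT.
- by rewrite bigcup_const.
- move=> _; rewrite m12; last exact: counting_eventsT.
  rewrite (_ : m2 setT = sigma B); last by rewrite -insertion_strip// -(stripE setT).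
  apply: le_lt_trans (sigma_compact_lty cL).
  by apply: le_measure; rewrite ?inE//; exact: measurable_compact.
Qed.

Let mecke_strip E B L : measurable E -> measurable B -> B `<=` L -> compact L ->
  campbell P sX (E `&` (setT `*` B)) = insertion sigma P sX (E `&` (setT `*` B)).
Proof.
move=> mE mB BL cL.
have mTB : measurable ([set: config X] `*` B) by exact: measurableX.
pose m1 := [the {measure set (config X * X) -> \bar R} of mrestr (campbell P sX) mTB].
pose m2 := [the {measure set (config X * X) -> \bar R} of mrestr (insertion sigma P sX) mTB].
have rE F (C : set X) : (F `*` C) `&` ([set: config X] `*` B) = F `*` (C `&` B).
  by rewrite -setXI setIT.
have BCL C : C `&` B `<=` L by move=> x [_ /BL].
suff : m1 E = m2 E by [].
apply: (measure_unique [set F `*` C | F in measurable & C in measurable] (fun=> setT)) => //.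
- exact: measurable_prod_measurableType.
- move=> _ _ [F1 mF1 [C1 mC1 <-]] [F2 mF2 [C2 mC2 <-]].
  exists (F1 `&` F2); first exact: measurableI.
  by exists (C1 `&` C2); [exact: measurableI|rewrite setXI].
- by move=> _; exists setT => //; exists setT => //; rewrite setXTT.
- by rewrite bigcup_const.
- move=> _ [F mF [C mC <-]]; rewrite /m1 /m2 /= /mrestr rE.
  by apply: mecke_rectangle cL => //; exact: measurableI.
- move=> _; rewrite (_ : m1 setT = sigma B).
    apply: le_lt_trans (sigma_compact_lty cL).
    by apply: le_measure; rewrite ?inE//; exact: measurable_compact.
  by rewrite -insertion_strip// -(mecke_rectangle _ _ BL)// /m1/= /mrestr setTI.
Qed.

Lemma campbell_insertion E : measurable E -> campbell P sX E = insertion sigma P sX E.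
Proof.
move=> mE; have [K [cK KT]] := sX.
have mD n : measurable (seqDU K n).
  apply: measurableD; first exact: (measurable_compact (@cK n)).
  by apply: bigsetU_measurable => i _; exact: (measurable_compact (@cK i)).
have EE : E = \bigcup_n (E `&` ([set: config X] `*` seqDU K n)).
  rewrite -setI_bigcupr -[LHS]setIT; congr (_ `&` _); apply/seteqP; split => // -[w x] _.
  have : (\bigcup_n seqDU K n) x by rewrite -seqDU_bigcup_eq KT.
  by move=> [n _ xn]; exists n.
have mEn n : measurable (E `&` ([set: config X] `*` seqDU K n)).
  by apply: measurableI => //; exact: measurableX.
have tEn : trivIset setT (fun n => E `&` ([set: config X] `*` seqDU K n)).
  apply: trivIset_setIl; apply/trivIsetP => i j _ _ ij.
  by rewrite -setXI; move/trivIsetP : (@trivIset_seqDU _ K) => -> //; rewrite setX0.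
rewrite EE !measure_semi_bigcup//; try exact: bigcup_measurable.
apply: eq_eseriesr => n _.
by apply: (mecke_strip _ _ _ (@cK n)) => //; exact: subset_seqDU.
Qed.

(** The Mecke formula: summing over the points of a Poisson configuration amounts
to inserting a point drawn from the intensity. *)
Lemma mecke_formula (f : config X * X -> \bar R) :
  (forall p, 0 <= f p) -> measurable_fun setT f ->
  \int[P]_w \int[point_measure w]_x f (w, x) = \int[sigma]_x \int[P]_w f (add_pt w x, x).
Proof.
move=> f0 mf; rewrite -(integral_campbell P sX)// -(integral_insertion sigma P sX)//.
by apply: eq_measure_integral => E mE _; exact: campbell_insertion.
Qed.

End mecke_formula.

(** * Mixed iterated integrals *)

Section mixed_integral.
Local Open Scope ereal_scope.
Context (d : measure_display) (R : realType) (X : borelMetricType d R).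
Variables (sigma : {sigma_finite_measure set X -> \bar R}) (K : set X).
Hypotheses (sX : sigma_compact X) (cK : compact K).

(** Iterated integral over K of f(w, s_1, ..., s_N), where the variables p with [b p]
run through the points of the configuration.  Such a point is deleted before the
next variables are integrated, so the points picked are distinct and f is
evaluated at the configuration that is left. *)
Fixpoint mixed_integral N : ('I_N -> bool) -> (config X -> N.-tuple X -> \bar R) ->
    config X -> \bar R :=
  match N with
  | 0 => fun _ f w => f w [tuple]
  | N'.+1 => fun b f w =>
      let g t := mixed_integral (fun p => b (lift ord0 p))
                   (fun w' s => f w' [tuple of t :: s]) in
      if b ord0 then \int[point_measure w]_(t in K) g t (del_pt w t)
      else \int[sigma]_(t in K) g t w
  end.

Lemma mixed_integral_ge0 N b (f : config X -> N.-tuple X -> \bar R) w :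
  (forall w s, 0 <= f w s) -> 0 <= mixed_integral b f w.
Proof.
elim: N => [|N IHN] //= in b f w * => f0.
by case: ifP => _; apply: integral_ge0 => t _; exact: IHN.
Qed.

Let mK : measurable K := measurable_compact cK.

Lemma measurable_integral_sigma d' (Z : measurableType d') (f : Z * X -> \bar R) :
  (forall p, 0 <= f p) -> measurable_fun [set: Z * X] f ->
  measurable_fun [set: Z] (fun z => \int[sigma]_(t in K) f (z, t)).
Proof.
move=> f0 mf; under eq_fun do rewrite integral_mkcond.
pose h (p : Z * X) := f p * (\1_(setT `*` K) p)%:E.
rewrite (_ : (fun _ => _) = fun z => \int[sigma]_t h (z, t)).
  apply: (measurable_fun_fubini_tonelli_F h).
    apply: emeasurable_funM => //.
    by apply/measurable_EFinP; apply: measurable_indic; exact: measurableX.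
  by move=> p; rewrite mule_ge0// lee_fin.
apply/funext => z; apply: eq_integral => t _.
by rewrite /h patchE indicE in_setX in_setT/=; case: ifP; rewrite ?mule1 ?mule0.
Qed.

(** A parameter space Z is carried along so that the induction can move the first
integration variable into it. *)
Lemma measurable_mixed_integral N b d' (Z : measurableType d')
    (f : Z -> config X -> N.-tuple X -> \bar R) (g : Z -> config X) :
  (forall z w s, 0 <= f z w s) ->
  measurable_fun [set: Z * config X * N.-tuple X] (fun p => f p.1.1 p.1.2 p.2) ->
  measurable_fun [set: Z] g ->
  measurable_fun [set: Z] (fun z => mixed_integral b (f z) (g z)).
Proof.
elim: N => [|N IHN] in b d' Z f g * => f0 mf mg /=.
  apply: (measurableT_comp mf (g := fun z => (z, g z, [tuple]))).
  by apply: measurable_fun_pair => //; apply: measurable_fun_pair.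
pose f' (zt : Z * X) w (s : N.-tuple X) := f zt.1 w [tuple of zt.2 :: s].
have f'0 z w s : 0 <= f' z w s by exact: f0.
have mf' : measurable_fun [set: Z * X * config X * N.-tuple X]
    (fun p => f' p.1.1 p.1.2 p.2).
  apply: (measurableT_comp mf (g := fun p : Z * X * config X * N.-tuple X =>
    (p.1.1.1, p.1.2, [tuple of p.1.1.2 :: p.2]))).
  apply: measurable_fun_pair.
    apply: measurable_fun_pair.
      by do 2 apply: measurableT_comp => //.
    by apply: measurableT_comp => //.
  by apply: measurable_cons => //; do 2 apply: measurableT_comp => //.
case: (b ord0).
  apply: (@measurable_integral_point_measure _ _ _ _ _ _ _ (fun zt =>
    mixed_integral (fun p => b (lift ord0 p)) (f' zt) (del_pt (g zt.1) zt.2))) => //.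
    by move=> p; exact: mixed_integral_ge0.
  apply: IHN => //.
  apply: (measurableT_comp (measurable_del_pt sX) (g := fun zt : Z * X => (g zt.1, zt.2))).
  by apply: measurable_fun_pair => //; exact: measurableT_comp.
apply: (@measurable_integral_sigma _ _ (fun zt =>
    mixed_integral (fun p => b (lift ord0 p)) (f' zt) (g zt.1))) => //.
  by move=> p; exact: mixed_integral_ge0.
by apply: IHN => //; exact: measurableT_comp.
Qed.

Variables (P : probability (config X) R).
Hypothesis sigma0 : forall x : X, sigma [set x] = 0.
Hypothesis sigma_compact_lty : forall L : set X, compact L -> sigma L < +oo.
Hypothesis poissonP : is_poisson sigma P.

Let tonelli (f : config X * X -> \bar R) : (forall p, 0 <= f p) -> measurable_fun setT f ->
  \int[P]_w \int[sigma]_(t in K) f (w, t) = \int[sigma]_(t in K) \int[P]_w f (w, t).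
Proof.
move=> f0 mf; pose h (p : config X * X) := f p * (\1_(setT `*` K) p)%:E.
have h0 p : 0 <= h p by rewrite mule_ge0// lee_fin.
have mh : measurable_fun setT h.
  apply: emeasurable_funM => //.
  by apply/measurable_EFinP; apply: measurable_indic; exact: measurableX.
have hE w t : h (w, t) = (\1_K t)%:E * f (w, t).
  by rewrite /h muleC !indicE in_setX in_setT.
transitivity (\int[P]_w \int[sigma]_t h (w, t)).
  apply: eq_integral => w _; rewrite [LHS]integral_mkcond; apply: eq_integral => t _.
  by rewrite hE patchE indicE; case: ifP; rewrite ?mul1e ?mul0e.
rewrite fubini_tonelli// [RHS]integral_mkcond; apply: eq_integral => t _.
rewrite patchE; under eq_integral do rewrite hE indicE.
case: ifP => _; first by under eq_integral do rewrite mul1e.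
by rewrite integral0_eq// => w _; rewrite mul0e.
Qed.

(** The multivariate Mecke formula, one variable at a time: inserting t and then
deleting it gives back the configuration, which almost surely does not contain
t. *)
Lemma integral_mixed_integral N b (f : config X -> N.-tuple X -> \bar R) :
  (forall w s, 0 <= f w s) ->
  measurable_fun [set: config X * N.-tuple X] (fun p => f p.1 p.2) ->
  \int[P]_w mixed_integral b f w = \int[P]_w mixed_integral (fun=> false) f w.
Proof.
elim: N => [//|N IHN] in b f *; move=> f0 mf /=.
pose f' t w (s : N.-tuple X) := f w [tuple of t :: s].
pose b' p := b (lift ord0 p).
have f'0 t w s : 0 <= f' t w s by exact: f0.
have mf' : measurable_fun [set: X * config X * N.-tuple X] (fun p => f' p.1.1 p.1.2 p.2).
  apply: (measurableT_comp mf (g := fun p : X * config X * N.-tuple X =>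
    (p.1.2, [tuple of p.1.1 :: p.2]))).
  apply: measurable_fun_pair; first by apply: measurableT_comp => //.
  by apply: measurable_cons => //; apply: measurableT_comp.
have mf'1 t : measurable_fun [set: config X * N.-tuple X] (fun p => f' t p.1 p.2).
  apply: (measurableT_comp mf' (g := fun p : config X * N.-tuple X => (t, p.1, p.2))).
  by apply: measurable_fun_pair => //; exact: measurable_fun_pair.
have mF c : measurable_fun setT (fun p : config X * X => mixed_integral c (f' p.2) p.1).
  apply: (@measurable_mixed_integral N c _ _ (fun p : config X * X => f' p.2) fst) => //.
  apply: (measurableT_comp mf' (g := fun p : config X * X * config X * N.-tuple X =>
    (p.1.1.2, p.1.2, p.2))).
  apply: measurable_fun_pair => //; apply: measurable_fun_pair.
    by do 2 apply: measurableT_comp => //.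
  by apply: measurableT_comp.
transitivity (\int[sigma]_(t in K) \int[P]_w mixed_integral b' (f' t) w); last first.
  under eq_integral do rewrite IHN//.
  by rewrite -(tonelli (f := fun p => mixed_integral (fun=> false) (f' p.2) p.1))// =>
    p; exact: mixed_integral_ge0.
case: (b ord0); last first.
  by rewrite -(tonelli (f := fun p => mixed_integral b' (f' p.2) p.1))// =>
    p; exact: mixed_integral_ge0.
pose F (p : config X * X) := (\1_(setT `*` K) p)%:E * mixed_integral b' (f' p.2) (del_pt p.1 p.2).
have F0 p : 0 <= F p.
  by rewrite mule_ge0 ?lee_fin//; exact: mixed_integral_ge0.
have mG : measurable_fun setT (fun p : config X * X => mixed_integral b' (f' p.2) (del_pt p.1 p.2)).
  apply: (@measurable_mixed_integral N b' _ _ (fun p : config X * X => f' p.2)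
      (fun p => del_pt p.1 p.2)) => //; last exact: measurable_del_pt.
  apply: (measurableT_comp mf' (g := fun p : config X * X * config X * N.-tuple X =>
    (p.1.1.2, p.1.2, p.2))).
  apply: measurable_fun_pair => //; apply: measurable_fun_pair.
    by do 2 apply: measurableT_comp => //.
  by apply: measurableT_comp.
have mF' : measurable_fun setT F.
  apply: emeasurable_funM => //.
  by apply/measurable_EFinP; apply: measurable_indic; exact: measurableX.
have FE w t : F (w, t) = (\1_K t)%:E * mixed_integral b' (f' t) (del_pt w t).
  by rewrite /F !indicE in_setX in_setT.
transitivity (\int[P]_w \int[point_measure w]_t F (w, t)).
  apply: eq_integral => w _; rewrite [LHS]integral_mkcond; apply: eq_integral => t _.
  by rewrite FE patchE indicE; case: ifP; rewrite ?mul1e ?mul0e.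
rewrite (mecke_formula sX sigma0 sigma_compact_lty poissonP F0 mF').
rewrite [RHS]integral_mkcond; apply: eq_integral => t _.
rewrite patchE; under eq_integral do rewrite FE indicE.
case: ifP => _; last by rewrite integral0_eq// => w _; rewrite mul0e.
under eq_integral do rewrite mul1e.
apply: ae_eq_integral => //.
- apply: (measurableT_comp mG (g := fun w => (add_pt w t, t))).
  apply: measurable_fun_pair => //.
  exact: (measurableT_comp (measurable_add_pt sX) (pair2_measurable t)).
- exact: (measurableT_comp (mF b') (pair2_measurable t)).
- exists [set w : config X | points w t]; split.
  + rewrite -[X in measurable X]setTI.
    exact: (pair2_measurable t measurableT (measurable_mem_config sX)).
  + exact: fixed_point0 poissonP t.
  + by move=> w /= nE; apply: contrapT => wt; apply: nE => _; rewrite add_ptK.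
Qed.

End mixed_integral.

Lemma mixed_integral_false d (R : realType) (X : borelMetricType d R)
    (sigma : {sigma_finite_measure set X -> \bar R}) (K : set X) N
    (f : config X -> N.-tuple X -> \bar R) w :
  mixed_integral sigma K (fun=> false) f w =
  mixed_integral sigma K (fun=> false) (fun=> f w) w.
Proof.
elim: N => [//|N IHN] /= in f *.
by apply: eq_integral => t _; rewrite IHN.
Qed.

(** * Evaluation on products of indicators *)

(** One term of the expansion of a product of Charlier polynomials: the variables of
color i with [b p] yield a falling factorial of [x i], the others powers of
[l i].  The truncated subtraction is harmless: once [x i] reaches 0 the product
vanishes. *)
Fixpoint mixed_monomial (R : realType) (I : eqType) (x : I -> nat) (l : I -> R) N :
    ('I_N -> bool) -> ('I_N -> I) -> R :=
  match N with
  | 0 => fun _ _ => 1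
  | N'.+1 => fun b c =>
      let b' p := b (lift ord0 p) in let c' p := c (lift ord0 p) in
      if b ord0
      then (x (c ord0))%:R * mixed_monomial (fun i => x i - (i == c ord0))%N l b' c'
      else l (c ord0) * mixed_monomial x l b' c'
  end.

Lemma mixed_monomial_ge0 (R : realType) (I : eqType) (x : I -> nat) (l : I -> R) N
    (b : 'I_N -> bool) c :
  (forall i, 0 <= l i) -> 0 <= mixed_monomial x l b c.
Proof.
move=> l0; elim: N => [|N IHN] //= in x b c *.
by case: ifP => _; rewrite mulr_ge0.
Qed.

Section evaluation.
Context (d : measure_display) (R : realType) (X : borelMetricType d R).
Variables (sigma : {sigma_finite_measure set X -> \bar R}) (K : set X).
Hypotheses (sX : sigma_compact X) (cK : compact K).
Hypothesis sK : (sigma K < +oo)%E.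
Context (I : eqType) (M L : I -> set X).
Hypotheses (mM : forall i, measurable (M i)) (MK : forall i, M i `<=` K).
Hypotheses (mL : forall i, measurable (L i)) (LK : forall i, L i `<=` K).

Let mK : measurable K := measurable_compact cK.

Lemma npts_del (w : config X) x i : points w x ->
  npts w (M i) = (npts (del_pt w x) (M i) + (x \in M i))%N.
Proof.
move=> wx; apply/eqP; rewrite -(eqr_nat R) -eqe natrD EFinD.
rewrite -!(point_measure_compact _ cK (@MK i)) (point_measure_del _ wx) diracE.
exact/eqP.
Qed.

(** The assumption on f only concerns the arguments that the iterated integral
reaches: distinct points of w at the places [b p], and w' equal to w without
them.  Since no point of w lies in two of the sets [M i], deleting a point of
[M (c ord0)] lowers the count of that color only. *)
Lemma mixed_integral_eval N (b : 'I_N -> bool) (c : 'I_N -> I)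
    (f : config X -> N.-tuple X -> \bar R) (w : config X) (a : R) :
  0 <= a ->
  (forall w s, 0 <= f w s)%E ->
  measurable_fun [set: config X * N.-tuple X] (fun p => f p.1 p.2) ->
  (forall i j t, points w t -> M i t -> M j t -> i = j) ->
  (forall s (w' : config X),
    (forall p, K (tnth s p)) ->
    (forall p, b p -> points w (tnth s p)) ->
    (forall p q, b p -> b q -> tnth s p = tnth s q -> p = q) ->
    (forall x, points w' x <-> points w x /\ forall p, b p -> x <> tnth s p) ->
    f w' s = (a * \prod_p \1_(if b p then M (c p) else L (c p)) (tnth s p))%:E) ->
  mixed_integral sigma K b f w =
  (a * mixed_monomial (fun i => npts w (M i)) (fun i => fine (sigma (L i))) b c)%:E.
Proof.
have l0 i : 0 <= fine (sigma (L i)) by exact: fine_ge0.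
have sL i : (sigma (L i) < +oo)%E.
  by apply: le_lt_trans sK; apply: le_measure; rewrite ?inE//; exact: LK.
elim: N => [|N IHN] in b c f w a * => a0 f0 mf disj fE /=.
  rewrite (fE _ w) ?big_ord0//; try by case.
  by move=> x; split => [wx|[]//]; split => // -[].
pose f' t w (s : N.-tuple X) := f w [tuple of t :: s].
pose b' p := b (lift ord0 p); pose c' p := c (lift ord0 p).
have f'0 t w' s : (0 <= f' t w' s)%E by exact: f0.
have mf' t : measurable_fun [set: config X * N.-tuple X] (fun p => f' t p.1 p.2).
  apply: (measurableT_comp mf (g := fun p : config X * N.-tuple X =>
    (p.1, [tuple of t :: p.2]))).
  by apply: measurable_fun_pair => //; exact: measurable_cons.
pose h := if b ord0 then M (c ord0) else L (c ord0).
case: ifP => b0.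
  pose C := a * mixed_monomial (fun i => npts w (M i) - (i == c ord0))%N
     (fun i => fine (sigma (L i))) b' c'.
  have C0 : 0 <= C by rewrite mulr_ge0// mixed_monomial_ge0.
  transitivity (\int[point_measure w]_(t in K) (C%:E * (\1_(M (c ord0)) t)%:E))%E.
    apply: integral_point_measure_eq => //.
    - apply: measurable_funTS.
      apply: (@measurable_mixed_integral _ _ _ sigma K sX cK N b' _ X f'
        (fun t => del_pt w t)) => //.
        apply: (measurableT_comp mf (g := fun p : X * config X * N.-tuple X =>
          (p.1.2, [tuple of p.1.1 :: p.2]))).
        apply: measurable_fun_pair; first exact: measurableT_comp.
        by apply: measurable_cons => //; exact: measurableT_comp.
      exact: (measurableT_comp (measurable_del_pt sX) (pair1_measurable w)).
    - apply: measurable_funeM; apply: measurable_funTS.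
      exact/measurable_EFinP/measurable_indic.
    move=> t wt Kt; rewrite (IHN b' c' (f' t) _ (a * \1_(M (c ord0)) t))//.
    - rewrite -EFinM; congr _%:E; rewrite indicE.
      have [tM|tM] := boolP (t \in M (c ord0)); last by rewrite !mulr0 mul0r.
      rewrite !mulr1 /C; congr (a * _).
      rewrite (_ : (fun i => npts (del_pt w t) (M i)) =
        fun i => (npts w (M i) - (i == c ord0))%N)//; apply/funext => i.
      (* the deleted point is counted for the color [c ord0] and no other *)
      rewrite [in RHS](npts_del i wt) (_ : (t \in M i) = (i == c ord0)) ?addnK//.
      apply/idP/eqP => [tMi|-> //].
      by apply: (disj _ _ t); [|exact: set_mem|exact: set_mem].
    - by rewrite mulr_ge0.
    - by move=> i j y [wy _]; exact: disj.
    - move=> s w' Ks ws sinj w'E; rewrite /f' (fE _ w').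
      + rewrite big_ord_recl b0 tnth0 mulrA; congr (_ * _)%:E.
        by apply: eq_bigr => p _; rewrite tnthS.
      + by move=> p; case: (unliftP ord0 p) => [q|] ->; rewrite ?tnthS ?tnth0.
      + by move=> p; case: (unliftP ord0 p) => [q|] -> bp; rewrite ?tnthS ?tnth0//; have [] := ws _ bp.
      + move=> p q; case: (unliftP ord0 p) => [p'|] ->; case: (unliftP ord0 q) => [q'|] -> bp bq //;
          rewrite ?tnthS ?tnth0.
        * by move=> /sinj ->.
        * by move=> pt; have [_] := ws _ bp; rewrite pt => /(_ erefl).
        * by move=> pt; have [_] := ws _ bq; rewrite -pt => /(_ erefl).
      + move=> x; rewrite w'E; split.
          move=> [[wx xt] xs]; split => // p.
          by case: (unliftP ord0 p) => [q|] ->; rewrite ?tnthS ?tnth0 => // /xs.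
        move=> [wx xs]; split; first by split => //; have := xs _ b0; rewrite tnth0.
        by move=> p bp; have := xs _ bp; rewrite tnthS.
  rewrite ge0_integralZl//; last exact/measurable_EFinP/measurable_indic.
  rewrite integral_indic// setIidl; last exact: MK.
  rewrite [X in (_ * X)%E](_ : _ = (npts w (M (c ord0)))%:R%:E); last first.
    exact: (point_measure_compact _ cK (@MK _)).
  by rewrite -EFinM /C mulrC mulrCA.
pose C := a * mixed_monomial (fun i => npts w (M i))
     (fun i => fine (sigma (L i))) b' c'.
have C0 : 0 <= C by rewrite mulr_ge0// mixed_monomial_ge0.
transitivity (\int[sigma]_(t in K) (C%:E * (\1_(L (c ord0)) t)%:E))%E.
  apply: eq_integral => t /set_mem Kt; rewrite (IHN b' c' (f' t) _ (a * \1_(L (c ord0)) t))//.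
  - by rewrite -EFinM mulrAC.
  - by rewrite mulr_ge0.
  - move=> s w' Ks ws sinj w'E; rewrite /f' (fE _ w').
    + rewrite big_ord_recl b0 tnth0 mulrA; congr (_ * _)%:E.
      by apply: eq_bigr => p _; rewrite tnthS.
    + by move=> p; case: (unliftP ord0 p) => [q|] ->; rewrite ?tnthS ?tnth0.
    + by move=> p; case: (unliftP ord0 p) => [q|] ->; rewrite ?b0// tnthS; exact: ws.
    + move=> p q; case: (unliftP ord0 p) => [p'|] ->; case: (unliftP ord0 q) => [q'|] ->;
        rewrite ?b0//.
      by rewrite !tnthS => bp bq /sinj ->.
    + move=> x; rewrite w'E; split => -[wx xs]; split => // p.
        by case: (unliftP ord0 p) => [q|] ->; rewrite ?b0// tnthS; exact: xs.
      by move=> bp; have := xs _ bp; rewrite tnthS.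
rewrite ge0_integralZl//; last exact/measurable_EFinP/measurable_indic.
rewrite integral_indic// setIidl; last exact: LK.
rewrite [X in (_ * X)%E](_ : _ = (fine (sigma (L (c ord0))))%:E); last first.
  by rewrite fineK// ge0_fin_numE.
by rewrite -EFinM /C mulrC mulrCA.
Qed.

End evaluation.

(** * Charlier polynomials at natural numbers *)

Lemma sum_geometric_le (R : realType) (q : R) n m : 0 <= q -> q <= 1 / 2 ->
  (n <= m)%N -> \sum_(n <= k < m) q ^+ k <= 2 * (q ^+ n - q ^+ m).
Proof.
move=> q0 q1; elim: m => [|m IHm]; first by rewrite leqn0 => /eqP ->; rewrite big_geq// subrr mulr0.
rewrite leq_eqVlt => /predU1P[->|nm]; first by rewrite big_geq// subrr mulr0.
rewrite big_nat_recr//=; have := IHm nm.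
have : 0 <= q ^+ m by exact: exprn_ge0.
by rewrite exprS; nra.
Qed.

(** If a n is the first nonzero coefficient, then the tail of the series is
O(r^(n+1)) for r < 1/4, by geometric domination with the bound on the
coefficients given by convergence at 1/2; dividing by r^n and letting r tend to 0
gives a contradiction. *)
Lemma powerseries_eq0 (R : realType) (a : R^nat) :
  (forall r : R, -1 < r -> r < 1 -> series (fun n => r ^+ n * a n) @ \oo --> (0 : R)) ->
  forall n, a n = 0.
Proof.
move=> h.
have [M M0 aM] : exists2 M : R, 0 < M & forall k, `|a k| <= M * 2 ^+ k.
  have /cvg_series_cvg_0/cvgP/cvg_seq_bounded : cvgn (series (fun n => (1/2 : R) ^+ n * a n)).
    by apply/cvg_ex; exists 0; apply: h; lra.
  move=> [B [_ /(_ (`|B| + 1))]]; rewrite (le_lt_trans (ler_norm _)) ?ltrDl// => /(_ isT) HB.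
  exists (`|B| + 1) => [|k]; first by rewrite ltr_wpDl.
  have := HB k Logic.I; rewrite /= normrM normrX ger0_norm; last by lra.
  rewrite expr_div_n expr1n div1r mulrC ler_pdivrMr ?exprn_gt0//.
elim/ltn_ind => n IHn; apply/eqP/negPn/negP => an0.
have bound (r : R) : 0 < r -> r < 1 / 4 -> `|a n| <= M * 2 ^+ n.+2 * r.
  move=> r0 r1; rewrite leNgt; apply/negP => lt.
  pose B := M * 2 * (2 * r) ^+ n.+1.
  have e0 : 0 < r ^+ n * `|a n| - B.
    have -> : B = r ^+ n * (M * 2 ^+ n.+2 * r) by rewrite /B exprMn !exprS; ring.
    by rewrite subr_gt0 ltr_pM2l// exprn_gt0.
  have rN1 : -1 < r by lra.
  have r1' : r < 1 by lra.
  have /cvgr0_norm_lt/(_ _ e0) [m _ Hm] := h r rN1 r1'.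
  have := Hm (maxn m n.+1) (leq_maxl _ _); set k := maxn _ _ => /=.
  have nk : (n < k)%N by exact: leq_maxr.
  rewrite /series/= (@big_cat_nat _ _ _ n)//=; last exact: ltnW.
  rewrite [X in X + _]big_nat_cond big1 ?add0r; last first.
    by move=> i /andP[/andP[_ ni] _]; rewrite IHn// mulr0.
  rewrite big_ltn//= => lt2.
  have tail : `|\sum_(n.+1 <= i < k) r ^+ i * a i| <= B.
    apply: le_trans (ler_norm_sum _ _ _) _.
    apply: (@le_trans _ _ (\sum_(n.+1 <= i < k) M * (2 * r) ^+ i)).
      apply: ler_sum => i _; rewrite normrM normrX gtr0_norm// exprMn mulrA mulrC.
      by rewrite ler_wpM2r// exprn_ge0// ltW.
    rewrite -mulr_sumr /B -mulrA; apply: ler_wpM2l; first exact: ltW.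
    have q0 : 0 <= 2 * r by lra.
    have q1 : 2 * r <= 1 / 2 by lra.
    apply: le_trans (sum_geometric_le q0 q1 nk) _.
    by rewrite ler_wpM2l// gerBl exprn_ge0.
  have := lerB_normD (r ^+ n * a n) (\sum_(n.+1 <= i < k) r ^+ i * a i).
  rewrite normrM normrX (gtr0_norm r0); lra.
have A0 : 0 < `|a n| by rewrite normr_gt0.
pose c := M * 2 ^+ n.+2.
have c0 : 0 < 2 * c by rewrite mulr_gt0// mulr_gt0// exprn_gt0.
pose r := Num.min (1 / 8) (`|a n| / (2 * c)).
have r0 : 0 < r by rewrite lt_min divr_gt0//= divr_gt0.
have r1 : r < 1 / 4 by rewrite gt_min; apply/orP; left; lra.
have := bound r r0 r1; apply/negP; rewrite -ltNge -/c.
have : r <= `|a n| / (2 * c) by rewrite ge_min lexx orbT.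
by rewrite (ler_pdivlMr _ _ c0); nra.
Qed.

Section charlier.
Context (R : realType) (C : nat -> R -> R -> R).
Hypothesis charlierC : is_charlier C.
Variable lam : R.

Let a (x : nat) n := C n x%:R lam / n`!%:R.

Let cvg_a (x : nat) (r : R) : -1 < r -> r < 1 ->
  series (fun n => r ^+ n * a x n) @ \oo --> expR (- (r * lam)) * (1 + r) ^+ x.
Proof.
move=> r0 r1; have := @charlierC x%:R lam r r0 r1.
rewrite powR_mulrn; last by lra.
rewrite (_ : (fun n => _) = (fun n => r ^+ n * a x n))//.
by apply/funext => n; rewrite /a mulrAC -mulrA.
Qed.

Let factN0 n : n`!%:R != 0 :> R.
Proof. by rewrite pnatr_eq0 -lt0n fact_gt0. Qed.

(** The generating function at x = 0 is the exponential series. *)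
Lemma charlier_at0 n : C n 0 lam = (- lam) ^+ n.
Proof.
suff : a 0 n - (- lam) ^+ n / n`!%:R = 0.
  by rewrite /a -mulrBl => /eqP; rewrite mulf_eq0 invr_eq0 (negPf (factN0 n)) orbF subr_eq0 => /eqP.
apply: (powerseries_eq0 (a := fun n => a 0 n - (- lam) ^+ n / n`!%:R)) => r r0 r1.
rewrite (_ : (fun n => _) = (fun n => r ^+ n * a 0 n) - exp_coeff (- (r * lam))).
  rewrite seriesD seriesN -(subrr (expR (- (r * lam)))); apply: cvgB.
    by have := @cvg_a 0 r r0 r1; rewrite expr0 mulr1.
  by rewrite /expR; exact: is_cvg_series_exp_coeff.
by apply/funext => m; rewrite /exp_coeff !fctE mulrBr; congr (_ - _); rewrite mulrA -exprMn mulrN.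
Qed.

(** Passing from x to x + 1 multiplies the generating function by 1 + r. *)
Lemma charlier_addn1 n (x : nat) :
  C n x.+1%:R lam = C n x%:R lam + n%:R * C n.-1 x%:R lam.
Proof.
pose b m := if m is k.+1 then a x k else 0.
have ab m : a x.+1 m - a x m - b m = 0.
  apply: (powerseries_eq0 (a := fun m => a x.+1 m - a x m - b m)) => r r0 r1.
  rewrite (_ : (fun n => _) = (fun n => r ^+ n * a x.+1 n) - (fun n => r ^+ n * a x n)
    - (fun n => r ^+ n * b n)); last by apply/funext => k; rewrite !fctE !mulrBr.
  have cb : series (fun m => r ^+ m * b m) @ \oo --> r * (expR (- (r * lam)) * (1 + r) ^+ x).
    rewrite -(cvg_shiftn 1)/= (_ : (fun m => _) = (fun m => r * series (fun n => r ^+ n * a x n) m)).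
      by apply: cvgMr; exact: cvg_a.
    apply/funext => k; rewrite addn1 /series/= big_nat_recl//= mulr0 add0r big_distrr/=.
    by apply: eq_bigr => i _; rewrite exprS mulrA.
  rewrite !seriesD !seriesN (_ : 0 = expR (- (r * lam)) * (1 + r) ^+ x.+1 - expR (- (r * lam)) * (1 + r) ^+ x
    - r * (expR (- (r * lam)) * (1 + r) ^+ x)); last by rewrite exprS; ring.
  by do 2 (apply: cvgB => //); exact: cvg_a.
have := ab n; case: n => [|n] /=.
  by rewrite subr0 /b /a fact0 !divr1 mul0r addr0 => /eqP; rewrite subr_eq0 => /eqP.
rewrite /a -mulrBl => /eqP; rewrite subr_eq0 => /eqP E.
rewrite -[LHS](subrK (C n.+1 x%:R lam)) addrC; congr (_ + _).
rewrite -[LHS](divfK (factN0 n.+1)) E factS natrM.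
by rewrite mulrCA divfK.
Qed.

Lemma charlier0 (x : nat) : C 0 x%:R lam = 1.
Proof.
by elim: x => [|x IHx]; rewrite ?charlier_at0 ?expr0// charlier_addn1 IHx mul0r addr0.
Qed.

(** Induction on k and then on x, from the relation between x and x + 1. *)
Lemma charlier_rec k (x : nat) :
  C k.+1 x%:R lam = x%:R * C k x.-1%:R lam - lam * C k x%:R lam.
Proof.
elim: k x => [|k IHk] x.
  elim: x => [|x IHx]; first by rewrite !charlier_at0 expr1 expr0 mul0r; ring.
  rewrite charlier_addn1 IHx/=.
  by rewrite !charlier0 -[in RHS]natr1; ring.
elim: x => [|x IHx]; first by rewrite !charlier_at0 [in LHS]exprS mul0r; ring.
rewrite charlier_addn1 IHx/= [C k.+1 x.+1%:R lam]charlier_addn1/=.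
have Rk := IHk x; case: x => [|y] /= in IHx Rk *.
  by rewrite Rk; ring.
have := charlier_addn1 k.+1 y => /= Cy.
move: Rk Cy; set A := C k.+1 y.+1%:R lam; set B := C k y.+1%:R lam.
set D := C k.+1 y%:R lam; set F := C k y%:R lam => Rk Cy.
have -> : D = A - k.+1%:R * F by rewrite Cy addrK.
have yF : y.+1%:R * F = A + lam * B by rewrite Rk subrK.
rewrite mulrBr (mulrCA y.+1%:R) yF -[y.+2%:R]natr1 -[k.+2%:R]natr1; ring.
Qed.

End charlier.

Lemma measurable_charlier_nat (R : realType) (C : nat -> R -> R -> R) (m k : nat) :
  is_charlier C -> measurable_fun setT (C k m%:R).
Proof.
move=> charlierC; elim: k m => [|k IHk] m.
  by rewrite (_ : C _ _ = fun=> 1)//; apply/funext => l; exact: charlier0.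
rewrite (_ : C _ _ = fun l => m%:R * C k m.-1%:R l - l * C k m%:R l).
  by apply: measurable_funB; apply: measurable_funM.
by apply/funext => l; exact: charlier_rec.
Qed.

(** The polynomials are only identified at natural x, so the values of x are
sorted out first. *)
Lemma measurable_charlier d (T : measurableType d) (R : realType) (C : nat -> R -> R -> R)
    (k : nat) (x l : T -> R) :
  is_charlier C -> measurable_fun setT x -> measurable_fun setT l ->
  (forall t, exists m : nat, x t = m%:R) ->
  measurable_fun setT (fun t => C k (x t) (l t)).
Proof.
move=> charlierC mx ml xnat _ Y mY; rewrite setTI.
rewrite (_ : _ @^-1` _ = \bigcup_m (x @^-1` [set m%:R] `&` (C k m%:R \o l) @^-1` Y)).
  apply: bigcupT_measurable => m; apply: measurableI.
    by rewrite -[X in measurable X]setTI; exact: mx.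
  rewrite -[X in measurable X]setTI.
  exact: (measurableT_comp (measurable_charlier_nat _ _ charlierC) ml).
apply/seteqP; split => [t /= Yt|t [m _ [/= <-]]//].
by have [m xm] := xnat t; exists m => //; split; rewrite //= -xm.
Qed.

Section charlier_product.

Lemma big_set_ordS (V : nmodType) N (F : {set 'I_N.+1} -> V) :
  \sum_S F S = \sum_(S : {set 'I_N}) (F (ord0 |: lift ord0 @: S)%SET + F (lift ord0 @: S)%SET).
Proof.
have inj : injective (@lift N.+1 ord0) by exact: lift_inj.
rewrite big_split (bigID (fun S : {set 'I_N.+1} => ord0 \in S)) /=.
have n0 (S : {set 'I_N}) : (ord0 \in (lift ord0 @: S)%SET) = false.
  by apply/imsetP => -[p _ /eqP]; rewrite (negPf (neq_lift _ _)).
pose down (S : {set 'I_N.+1}) := [set p : 'I_N | lift ord0 p \in S]%SET.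
congr (_ + _).
  rewrite (reindex_onto (fun S : {set 'I_N} => (ord0 |: lift ord0 @: S)%SET) down) /=.
    apply: eq_bigl => S; rewrite finset.setU11; apply/eqP/setP => p.
    by rewrite !inE (mem_imset _ _ inj).
  move=> S S0; apply/setP => p; rewrite !inE; case: (unliftP ord0 p) => [q|] ->.
    by rewrite (mem_imset _ _ inj) inE.
  by rewrite eqxx S0.
rewrite (reindex_onto (fun S : {set 'I_N} => (lift ord0 @: S)%SET) down) /=.
  apply: eq_bigl => S; rewrite n0; apply/eqP/setP => p.
  by rewrite !inE (mem_imset _ _ inj).
move=> S S0; apply/setP => p; case: (unliftP ord0 p) => [q|] ->.
  by rewrite (mem_imset _ _ inj) inE.
by rewrite n0 (negPf S0).
Qed.

Definition set_sign (R : pzRingType) N (S : {set 'I_N}) : R :=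
  \prod_p (if p \in S then 1 else -1).

(** Summing over whether the first variable belongs to S reproduces the two terms of
[charlier_rec] for the color of that variable. *)
Lemma sum_mixed_monomial (R : realType) (C : nat -> R -> R -> R) (I : finType)
    (x : I -> nat) (l : I -> R) N (c : 'I_N -> I) :
  is_charlier C ->
  \sum_(S : {set 'I_N}) set_sign R S * mixed_monomial x l (fun p => p \in S) c =
  \prod_i C (\sum_(p < N) (c p == i))%N (x i)%:R (l i).
Proof.
move=> charlierC; elim: N => [|N IHN] in x c *.
  rewrite (big_pred1 finset.set0) => [|S]; last first.
    by apply/esym/eqP/setP => -[].
  rewrite /set_sign big_ord0 mul1r /= big1// => i _.
  by rewrite big_ord0 charlier0.
have inj : injective (@lift N.+1 ord0) by exact: lift_inj.
pose i0 := c ord0; pose c' p := c (lift ord0 p).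
rewrite big_set_ordS.
transitivity (\sum_(S : {set 'I_N}) ((x i0)%:R *
    (set_sign R S * mixed_monomial (fun i => x i - (i == i0))%N l (fun p => p \in S) c')
   - l i0 * (set_sign R S * mixed_monomial x l (fun p => p \in S) c'))).
  apply: eq_bigr => S _; rewrite /set_sign !big_ord_recl/=.
  have n0 : (ord0 \in (lift ord0 @: S)%SET) = false.
    by apply/imsetP => -[p _ /eqP]; rewrite (negPf (neq_lift _ _)).
  rewrite finset.setU11 n0 mul1r mulN1r.
  have e1 : (fun p => lift ord0 p \in (lift ord0 @: S)%SET) = (fun p => p \in S).
    by apply/funext => p; rewrite mem_imset.
  have e2 : (fun p => lift ord0 p \in (ord0 |: lift ord0 @: S)%SET) = (fun p => p \in S).
    by apply/funext => p; rewrite !inE mem_imset.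
  rewrite e1 e2 mulNr; congr (_ - _).
    rewrite mulrCA; congr (_ * (_ * _)); apply: eq_bigr => p _.
    by have := congr1 (@^~ p) e2 => /= ->.
  rewrite mulrCA; congr (_ * (_ * _)); apply: eq_bigr => p _.
  by have := congr1 (@^~ p) e1 => /= ->.
rewrite sumrB -!mulr_sumr !IHN.
have kE i : (\sum_(p < N.+1) (c p == i) = (i0 == i) + \sum_(p < N) (c' p == i))%N.
  by rewrite big_ord_recl.
under [RHS]eq_bigr do rewrite kE.
rewrite (bigD1 i0)//= [X in _ - l i0 * X](bigD1 i0)//= [RHS](bigD1 i0)//=.
rewrite eqxx add1n charlier_rec// subn1 mulrBl !mulrA; congr (_ * _ - _ * _).
  by apply: eq_bigr => i /negPf ni; rewrite ni subn0 eq_sym ni.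
by apply: eq_bigr => i /negPf ni; rewrite eq_sym ni.
Qed.

End charlier_product.

Lemma sum_block n (k : 'I_n -> nat) i :
  (\sum_(p < \sum_(j < n) k j) (block p == i))%N = k i.
Proof.
rewrite (reindex (@tagnat.rank n k)); last exact: tagnat.rank_bij_on.
rewrite (eq_bigr (fun x : {j & 'I_(k j)} => tag x == i : nat)); last first.
  by move=> x _; rewrite /block /tagnat.sig1 tagnat.rankK.
transitivity (\sum_(j < n) \sum_(q < k j) (j == i))%N.
  by rewrite (sig_big_dep _ (fun=> xpredT) (fun j (_ : 'I_(k j)) => (j == i : nat))).
rewrite (bigD1 i)//= [X in (_ + X)%N]big1 ?addn0; last first.
  by move=> j /negPf ji; rewrite big1// => q _; rewrite ji.
by rewrite eqxx sum1_card card_ord.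
Qed.

(** * Inclusion-exclusion for the finite difference operator *)

Section difference_expansion.
Context {R : realType} {X : topologicalType}.

Definition add_pts N (s : N.-tuple X) (r : seq 'I_N) (w : config X) : config X :=
  foldr (fun q w' => add_pt w' (tnth s q)) w r.

Lemma points_add_pts N (s : N.-tuple X) r w x :
  points (add_pts s r w) x <-> points w x \/ exists2 q, q \in r & x = tnth s q.
Proof.
elim: r => [|q r IHr] /=; first by split => [|[//|[]]//]; left.
split => [[/IHr[wx|[q' q'r ->]]|->]|[wx|[q']]].
- by left.
- by right; exists q' => //; rewrite inE q'r orbT.
- by right; exists q => //; rewrite inE eqxx.
- by left; apply/IHr; left.
- rewrite inE => /predU1P[->|q'r] xq; [by right|by left; apply/IHr; right; exists q'].
Qed.

Lemma add_pts_add_pt N (s : N.-tuple X) r w x :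
  add_pts s r (add_pt w x) = add_pt (add_pts s r w) x.
Proof.
elim: r => [//|q r IHr] /=; rewrite IHr; apply: config_eq.
by rewrite /= setUAC.
Qed.

(** Each 1 + D_s is the shift by s, and these operators commute; expanding the
product of the 1 + D_s over T gives the sum. *)
Lemma sum_diff_sub N (s : N.-tuple X) (T : {set 'I_N}) (F : config X -> R) w :
  \sum_(Th : {set 'I_N} | Th \subset T) diff_on s Th F w = F (add_pts s (enum T) w).
Proof.
have gen (r : seq 'I_N) : uniq r -> forall w,
    \sum_(Th : {set 'I_N} | Th \subset [set q in r]%SET)
      foldr (fun j => diff_at (tnth s j)) F [seq j <- r | j \in Th] w =
    F (add_pts s r w).
  elim: r => [_ w'|q r IHr /= /andP[qr ur] w'].
    rewrite (big_pred1 finset.set0)//= => S /=; rewrite -finset.subset0.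
    rewrite (_ : [set q in [::]]%SET = finset.set0)//.
  rewrite (bigID (fun Th : {set 'I_N} => q \in Th))/= addrC.
  have subE (Th : {set 'I_N}) : (Th \subset [set p in q :: r]%SET) && (q \notin Th) =
      (Th \subset [set p in r]%SET).
    apply/idP/idP => [/andP[/fintype.subsetP h qTh]|/fintype.subsetP h].
      apply/fintype.subsetP => p pTh.
      by have := h _ pTh; rewrite !inE => /predU1P[pq|//]; rewrite -pq pTh in qTh.
    apply/andP; split; first by apply/fintype.subsetP => p /h; rewrite !inE => ->; rewrite orbT.
    by apply/negP => /h; rewrite inE (negPf qr).
  rewrite (eq_bigl _ _ subE) [X in _ + X](reindex_onto (fun Th => (q |: Th)%SET) (fun Th => (Th :\ q)%SET))/=; last first.
    by move=> Th /andP[_ qTh]; rewrite finset.setD1K.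
  rewrite [X in _ + X](eq_bigl (fun Th : {set 'I_N} => Th \subset [set p in r]%SET)); last first.
    move=> Th; rewrite finset.setU11 andbT -subE.
    rewrite finset.subUset finset.sub1set !inE eqxx/=; congr (_ && _).
    apply/eqP/idP => [<-|qTh]; first by rewrite !inE eqxx.
    by apply/setP => p; rewrite !inE; case: eqP => [->|//]; rewrite (negPf qTh).
  rewrite -big_split/=.
  have -> : F (add_pt (add_pts s r w') (tnth s q)) = F (add_pts s r (add_pt w' (tnth s q))).
    by rewrite add_pts_add_pt.
  rewrite -IHr//; apply: eq_bigr => Th Thr.
  have qTh : q \notin Th by apply: contra qr => /(fintype.subsetP Thr); rewrite inE.
  rewrite (negPf qTh) finset.setU11/= /diff_at addrC.
  rewrite (_ : [seq j <- r | j \in (q |: Th)%SET] = [seq j <- r | j \in Th]) ?subrK//.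
  apply: eq_in_filter => p pr; rewrite !inE; case: eqP => [pq|//].
  by rewrite -pq pr in qr.
rewrite -gen ?enum_uniq//; apply: eq_big => [Th|Th ThT].
  by rewrite (_ : [set q in enum T]%SET = T)//; apply/setP => p; rewrite inE mem_enum.
rewrite /diff_on; congr (foldr _ _ _ w); rewrite /enum_mem -filter_predI.
apply: eq_filter => p /=; rewrite -!topredE/=.
by apply/idP/andP => [pTh|[]//]; split => //; exact: (fintype.subsetP ThT).
Qed.

(** The families Theta whose union is contained in S sum up to a product over p of
shifts by S \ p, by [sum_diff_sub]; the signs select the families whose union is
everything, as in Moebius inversion on the lattice of subsets. *)
Lemma Delta_inclusion_exclusion N (u : 'I_N -> config X -> X -> R) (s : N.-tuple X) w :
  Delta u s w = \sum_(S : {set 'I_N}) set_sign R S *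
    \prod_(p < N) u p (add_pts s (enum (S :\ p)%SET) w) (tnth s p).
Proof.
pose a (Th : {ffun 'I_N -> {set 'I_N}}) :=
  \prod_(p < N) diff_on s (Th p) (fun w' => u p w' (tnth s p)) w.
pose free (Th : {ffun 'I_N -> {set 'I_N}}) := [forall p, p \notin Th p].
pose un (Th : {ffun 'I_N -> {set 'I_N}}) := (\bigcup_p Th p)%SET.
transitivity (\sum_(S : {set 'I_N}) set_sign R S *
    \sum_(Th | (un Th \subset S) && free Th) a Th); last first.
  apply: eq_bigr => S _; congr (_ * _).
  under [RHS]eq_bigr do rewrite -(sum_diff_sub s _ (fun w' => u _ w' _)).
  rewrite (bigA_distr_big_dep (fun p (Th : {set 'I_N}) => Th \subset (S :\ p)%SET))/=.
  apply: eq_bigl => Th; apply/andP/familyP => [[/bigcupsP h /forallP f] p|h].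
    by rewrite unfold_in subsetD1 h//=.
  split; [apply/bigcupsP => p _|apply/forallP => p]; have := h p;
    by rewrite unfold_in subsetD1 => /andP[].
under [RHS]eq_bigr do rewrite big_distrr/=.
rewrite (exchange_big_dep free)/=; last by move=> S Th _ /andP[].
rewrite /Delta [RHS](bigID (fun Th => un Th == [set: 'I_N]%SET))/=.
have key (V : {set 'I_N}) : \sum_(S : {set 'I_N} | V \subset S) set_sign R S =
    (V == [set: 'I_N]%SET)%:R.
  transitivity (\prod_(p < N) (1 + (if p \in V then 0 else -1) : R)).
    rewrite bigA_distr/= big_mkcond; apply: eq_bigr => S _; rewrite /set_sign.
    case: ifPn => [VS|/fintype.subsetPn[p pV pS]].
      apply: eq_bigr => p _; case: ifPn => // pS; case: ifPn => // /(fintype.subsetP VS).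
      by rewrite (negPf pS).
    by rewrite (bigD1 p)//= (negPf pS) pV mul0r.
  case: eqVneq => [->|/eqP VT].
    by rewrite big1// => p _; rewrite inE addr0.
  have [p pV] : exists p, p \notin V.
    apply/existsP; apply: contrapT => /negP; rewrite negb_exists => /forallP h.
    by apply: VT; apply/setP => p; rewrite inE; have := h p; rewrite negbK.
  by rewrite (bigD1 p)//= (negPf pV) subrr mul0r.
have inner Th : free Th -> \sum_(S : {set 'I_N} | (un Th \subset S) && free Th) set_sign R S * a Th =
    (un Th == [set: 'I_N]%SET)%:R * a Th.
  by move=> fTh; rewrite -key mulr_suml; apply: eq_bigl => S; rewrite fTh andbT.
rewrite [X in _ + X]big1 ?addr0; last first.
  by move=> Th /andP[fTh /negPf nT]; rewrite inner// nT mul0r.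
apply: eq_big => [Th|Th /andP[/eqP unT fTh]]; first by rewrite andbC.
by rewrite inner// /un unT eqxx mul1r.
Qed.

End difference_expansion.

(** * Iterated integrals over a compact set *)

Lemma Rintegral_lincomb d (T : measurableType d) (R : realType)
    (mu : {measure set T -> \bar R}) (D : set T) (I : Type) (r : seq I) (c : I -> R)
    (g : I -> T -> R) : measurable D ->
  (forall i, mu.-integrable D (EFin \o g i)) ->
  \int[mu]_(x in D) (\sum_(i <- r) c i * g i x) = \sum_(i <- r) c i * \int[mu]_(x in D) g i x.
Proof.
move=> mD ig; elim: r => [|i r IHr].
  rewrite big_nil (@eq_Rintegral _ _ _ _ D (fun=> 0)); last by move=> x _; rewrite big_nil.
  by rewrite /Rintegral integral0_eq.
rewrite big_cons -IHr -RintegralZl// -RintegralD//.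
- by apply: eq_Rintegral => x _; rewrite big_cons.
- by have := integrableZl mD (c i) (ig i).
- rewrite (_ : EFin \o _ = fun x => \sum_(j <- r) ((c j)%:E * (g j x)%:E))%E.
    by apply: integrable_sum => // j _; exact: (integrableZl mD (c j) (ig j)).
  by apply/funext => x; rewrite /= -sumEFin.
Qed.

Lemma expectation_lincomb d (T : measurableType d) (R : realType)
    (P : probability T R) (I : finType) (c : I -> R) (g : I -> T -> R) :
  (forall i, P.-integrable setT (EFin \o g i)) ->
  (\int[P]_w (\sum_i c i * g i w)%:E = \sum_i (c i)%:E * \int[P]_w (g i w)%:E)%E.
Proof.
move=> ig; under eq_integral do rewrite -sumEFin.
rewrite (integral_sum measurableT (f := fun i w => (c i * g i w)%:E)).
  apply: eq_bigr => i _; under eq_integral do rewrite EFinM.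
  by rewrite integralZl//; exact: ig.
by move=> i; have := integrableZl measurableT (c i) (ig i).
Qed.

Lemma integrable_fine d (T : measurableType d) (R : realType)
    (mu : {measure set T -> \bar R}) (g : T -> \bar R) :
  measurable_fun setT g -> (forall t, 0 <= g t)%E -> (\int[mu]_t g t < +oo)%E ->
  mu.-integrable setT (EFin \o (fine \o g)) /\
  (\int[mu]_t (fine (g t))%:E = \int[mu]_t g t)%E.
Proof.
move=> mg g0 gfin.
have ig : mu.-integrable setT g.
  by apply/integrableP; split => //; under eq_integral do rewrite gee0_abs//.
have fE : (\int[mu]_t (fine (g t))%:E = \int[mu]_t g t)%E.
  apply: ae_eq_integral => //.
    by apply/measurable_EFinP; exact: (measurableT_comp _ mg).
  by apply: filterS (integrable_ae measurableT ig) => t /(_ Logic.I) gt _; rewrite fineK.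
split => //; apply/integrableP; split.
  by apply/measurable_EFinP; exact: (measurableT_comp _ mg).
under eq_integral do rewrite gee0_abs ?lee_fin ?fine_ge0//.
by rewrite /= fE.
Qed.

Section iterated_integral.
Context (d : measure_display) (R : realType) (X : borelMetricType d R).
Variables (sigma : {sigma_finite_measure set X -> \bar R}) (K : set X).
Hypotheses (sX : sigma_compact X) (cK : compact K) (sK : (sigma K < +oo)%E).

Let mK : measurable K := measurable_compact cK.

Let measurable_cons_fun N (f : N.+1.-tuple X -> R) : measurable_fun setT f ->
  measurable_fun setT (fun p : X * N.-tuple X => f [tuple of p.1 :: p.2]).
Proof.
move=> mf; apply: (measurableT_comp mf (g := fun p : X * N.-tuple X => [tuple of p.1 :: p.2])).
exact: measurable_cons.
Qed.

Let measurable_cons_fun1 N (f : N.+1.-tuple X -> R) x : measurable_fun setT f ->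
  measurable_fun setT (fun s : N.-tuple X => f [tuple of x :: s]).
Proof.
move=> /measurable_cons_fun mf.
exact: (measurableT_comp mf (pair1_measurable x)).
Qed.

Let measurable_mixed_cons N (f : N.+1.-tuple X -> R) w :
  (forall s, 0 <= f s) -> measurable_fun setT f ->
  measurable_fun setT (fun x => mixed_integral sigma K (fun=> false)
    (fun _ (s : N.-tuple X) => (f [tuple of x :: s])%:E) w).
Proof.
move=> f0 mf; apply: (@measurable_mixed_integral _ _ _ sigma K sX cK N (fun=> false) _ X
  (fun x _ (s : N.-tuple X) => (f [tuple of x :: s])%:E) (fun=> w)) => //.
  by move=> *; rewrite lee_fin.
apply/measurable_EFinP.
apply: (measurableT_comp (measurable_cons_fun mf)
  (g := fun p : X * config X * N.-tuple X => (p.1.1, p.2))).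
by apply: measurable_fun_pair => //; apply: measurableT_comp.
Qed.

(** The bound keeps all the integrals finite, so that the real-valued iterated
integral loses nothing when it applies [fine] at each stage. *)
Lemma mixed_iter_integral N (f : N.-tuple X -> R) w :
  measurable_fun setT f -> (forall s, 0 <= f s <= 1) ->
  mixed_integral sigma K (fun=> false) (fun _ s => (f s)%:E) w =
    (iter_integral sigma K f)%:E /\
  iter_integral sigma K f <= fine (sigma K) ^+ N.
Proof.
elim: N => [|N IHN] in f * => mf f01 /=.
  by split => //; rewrite expr0; case/andP: (f01 [tuple]).
have {}IHN x := IHN (fun s => f [tuple of x :: s]) (measurable_cons_fun1 x mf) (fun s => f01 _).
have f0 s : 0 <= f s by case/andP: (f01 s).
have int_le : (\int[sigma]_(x in K) (mixed_integral sigma K (fun=> false)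
    (fun _ (s : N.-tuple X) => (f [tuple of x :: s])%:E) w) <= (fine (sigma K) ^+ N.+1)%:E)%E.
  apply: (@le_trans _ _ (\int[sigma]_(x in K) (cst (fine (sigma K) ^+ N)%:E x)))%E.
    apply: ge0_le_integral => //.
    - by move=> x _; apply: mixed_integral_ge0 => *; rewrite lee_fin.
    - by apply: measurable_funTS; exact: measurable_mixed_cons.
    - by move=> x _; rewrite (IHN x).1 lee_fin (IHN x).2.
  rewrite integral_cst// exprSr EFinM fineK//.
  by rewrite ge0_fin_numE.
have int_ge0 : (0 <= \int[sigma]_(x in K) (mixed_integral sigma K (fun=> false)
    (fun _ (s : N.-tuple X) => (f [tuple of x :: s])%:E) w))%E.
  by apply: integral_ge0 => x _; apply: mixed_integral_ge0 => *; rewrite lee_fin.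
have iE : (\int[sigma]_(x in K) iter_integral sigma K (fun s => f [tuple of x :: s]))%:E =
  (\int[sigma]_(x in K) (mixed_integral sigma K (fun=> false)
    (fun _ (s : N.-tuple X) => (f [tuple of x :: s])%:E) w))%E.
  rewrite /Rintegral fineK.
    by apply: eq_integral => x _; rewrite (IHN x).1.
  under eq_integral do rewrite -(IHN _).1.
  by rewrite ge0_fin_numE// (le_lt_trans int_le)// ltry.
by split; [rewrite -iE|rewrite -lee_fin iE].
Qed.

Lemma iter_integral_lincomb N (I : finType) (c : I -> R) (f : I -> N.-tuple X -> R) :
  (forall i, measurable_fun setT (f i)) -> (forall i s, 0 <= f i s <= 1) ->
  iter_integral sigma K (fun s => \sum_i c i * f i s) =
  \sum_i c i * iter_integral sigma K (f i).
Proof.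
elim: N => [//|N IHN] in f * => mf f01 /=.
rewrite -Rintegral_lincomb//.
  apply: eq_Rintegral => x _; rewrite (IHN (fun i s => f i [tuple of x :: s]))//.
  by move=> i; exact: measurable_cons_fun1.
move=> i.
have f0 s : 0 <= f i s by case/andP: (f01 i s).
pose w : config X := point.
have E x := mixed_iter_integral w (measurable_cons_fun1 x (mf i)) (fun s => f01 i _).
have E' : EFin \o (fun x => iter_integral sigma K (fun s => f i [tuple of x :: s])) =
    fun x => mixed_integral sigma K (fun=> false) (fun _ (s : N.-tuple X) => (f i [tuple of x :: s])%:E) w.
  by apply/funext => x /=; rewrite (E x).1.
rewrite E'; apply/integrableP; split.
  by apply: measurable_funTS; exact: measurable_mixed_cons.
under eq_integral.
  move=> x _; rewrite gee0_abs; last by apply: mixed_integral_ge0 => *; rewrite lee_fin.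
  over.
have := (mixed_iter_integral w (mf i) (f01 i)).1 => /= ->.
exact: ltry.
Qed.

End iterated_integral.

(** * Random sets *)

(** A countable set is a countable union of null points. *)
Lemma diffuse_countable0 d (R : realType) (X : borelMetricType d R)
    (sigma : {measure set X -> \bar R}) (D : set X) :
  (forall x : X, sigma [set x] = 0%E) -> countable D -> sigma D = 0%E.
Proof.
move=> s0 cD; have /countable_injP[f finj] := cD.
apply: (measure_negligible (measurable_countable cD)).
pose F n := D `&` f @^-1` [set n].
have : sigma.-negligible (\bigcup_n F n).
  apply: negligible_bigcup => n.
  have [->|/set0P[x [Dx fx]]] := eqVneq (F n) set0; first exact: negligible_set0.
  exists [set x]; split; [exact: measurable_point|exact: s0|].
  by move=> y [Dy fy]; apply: finj; rewrite ?inE// fx fy.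
by apply: negligibleS => x Dx; exists (f x).
Qed.

Lemma measurable_random_setP d (R : realType) (X : borelMetricType d R)
    (A : config X -> set X) :
  measurable [set p : config X * X | A p.1 p.2] -> random_set A.
Proof.
move=> mA; rewrite /random_set (_ : (fun _ => _) = \1_[set p : config X * X | A p.1 p.2]).
  exact: measurable_indic.
by apply/funext => p; rewrite !indicE; congr (_ : bool)%:R; apply/idP/idP; rewrite !inE.
Qed.

Section random_sets.
Context (d : measure_display) (R : realType) (X : borelMetricType d R).
Variables (sigma : {sigma_finite_measure set X -> \bar R}).
Hypothesis sX : sigma_compact X.
Hypothesis sigma0 : forall x : X, sigma [set x] = 0%E.

Section one_random_set.
Variable A : config X -> set X.
Hypothesis rA : random_set A.

Lemma measurable_random_graph : measurable [set p : config X * X | A p.1 p.2].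
Proof.
rewrite (_ : [set p | _] = (fun p => \1_(A p.1) p.2 : R) @^-1` [set 1]).
  by rewrite -[X in measurable X]setTI; exact: rA.
apply/seteqP; split => p /=; rewrite indicE; first by move=> Ap; rewrite mem_set.
by have [/set_mem//|_ /eqP] := boolP (p.2 \in A p.1); rewrite eq_sym oner_eq0.
Qed.

Lemma measurable_random_set w : measurable (A w).
Proof.
rewrite -[A w]setTI.
exact: (pair1_measurable w measurableT measurable_random_graph).
Qed.

(** The points of w in [removal_set w] are those counted by delta(1_A) + sigma(A);
outside w it coincides with A w. *)
Definition removal_set w : set X := [set t | A (del_pt w t) t].

Lemma measurable_removal_graph : measurable [set p : config X * X | removal_set p.1 p.2].
Proof.
have mf : measurable_fun setT (fun p : config X * X => (del_pt p.1 p.2, p.2)).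
  by apply: measurable_fun_pair => //; exact: measurable_del_pt.
by rewrite -[X in measurable X]setTI; exact: (mf measurableT _ measurable_random_graph).
Qed.

Lemma measurable_removal_set w : measurable (removal_set w).
Proof.
rewrite -[removal_set w]setTI.
exact: (pair1_measurable w measurableT measurable_removal_graph).
Qed.

Lemma measurable_fun_sigma_random : measurable_fun setT (fun w => sigma (A w)).
Proof.
have := measurable_fun_xsection sigma measurable_random_graph.
congr measurable_fun; apply/funext => w /=; congr (sigma _).
by apply/seteqP; split => t; rewrite /xsection/= inE.
Qed.

Lemma measurable_fun_removal : measurable_fun setT
  (fun w : config X => point_measure w (removal_set w) : \bar R).
Proof.
rewrite (_ : (fun _ => _) = fun w : config X => \int[point_measure w]_(t in setT)
    (\1_[set p : config X * X | removal_set p.1 p.2] (w, t))%:E)%E.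
  apply: (@measurable_integral_point_measure _ _ _ _ _ id setT (fun p =>
    (\1_[set p : config X * X | removal_set p.1 p.2] p)%:E)) => //.
  by apply/measurable_EFinP; apply: measurable_indic; exact: measurable_removal_graph.
apply/funext => w.
transitivity (point_measure w (removal_set w `&` setT) : \bar R); first by rewrite setIT.
by rewrite -(integral_indic _ measurableT (measurable_removal_set w)).
Qed.

Lemma sigma_removal w : sigma (removal_set w) = sigma (A w).
Proof.
have sw : sigma (w : set X) = 0%E by exact/diffuse_countable0/countable_points.
have h B : measurable B -> sigma B = sigma (B `\` w).
  move=> mB; rewrite -[in LHS](setUIDK B w) setUC measureU0//.
  - by apply: measurableD => //; exact: measurable_config.
  - by apply: measurableI => //; exact: measurable_config.
  - apply: subset_measure0 sw => //; last exact: measurable_config.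
    by apply: measurableI => //; exact: measurable_config.
rewrite h; last exact: measurable_removal_set.
rewrite [RHS]h; last exact: measurable_random_set.
congr (sigma _); apply/seteqP; split => t [At wt]; split => //.
  by move: At; rewrite /removal_set/= del_pt_id.
by rewrite /removal_set/= del_pt_id.
Qed.

(** The compensator is the measure under sigma of [removal_set w], which differs
from A w only on the countable set w. *)
Lemma skorohod_indic w :
  skorohod sigma (fun w' t => \1_(A w') t) w + fine (sigma (A w)) =
  fine (point_measure w (removal_set w) : \bar R).
Proof.
rewrite /skorohod /Rintegral.
rewrite (eq_integral (fun t => (\1_(removal_set w) t)%:E))//.
rewrite (eq_integral (mu := sigma) (fun t => (\1_(removal_set w) t)%:E))//.
have mS := measurable_removal_set w.
rewrite !integral_indic// !setIT -(sigma_removal w); exact: subrK.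
Qed.

End one_random_set.

Variables (P : probability (config X) R).
Hypothesis sigma_compact_lty : forall L : set X, compact L -> (sigma L < +oo)%E.
Hypothesis poissonP : is_poisson sigma P.

(** By the Mecke formula the expected number of points t of w in A(w \ t) is the
expectation of sigma(A). *)
Lemma mecke_ae (A : config X -> set X) : random_set A ->
  (\forall w \ae P, sigma (A w) = 0%E) ->
  \forall w \ae P, forall t, points w t -> ~ A (del_pt w t) t.
Proof.
move=> rA A0.
pose G := [set p : config X * X | A p.1 p.2].
pose H := [set p : config X * X | removal_set A p.1 p.2].
have mG : measurable G by exact: measurable_random_graph.
have mH : measurable H by exact: measurable_removal_graph.
have mGi : measurable_fun setT (fun p : config X * X => (\1_G p)%:E : \bar R).
  exact/measurable_EFinP/measurable_indic.
have mHi : measurable_fun setT (fun p : config X * X => (\1_H p)%:E : \bar R).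
  exact/measurable_EFinP/measurable_indic.
have int0 : (\int[P]_w point_measure w (removal_set A w) = 0)%E.
  transitivity (\int[P]_w \int[point_measure w]_t (\1_H (w, t))%:E)%E.
    apply: eq_integral => w _.
    transitivity (point_measure w (removal_set A w `&` setT) : \bar R); first by rewrite setIT.
    by rewrite -(integral_indic _ measurableT (measurable_removal_set rA w)).
  rewrite (mecke_formula sX sigma0 sigma_compact_lty poissonP _ mHi); last first.
    by move=> p; rewrite lee_fin.
  transitivity (\int[sigma]_t \int[P]_w (\1_G (w, t))%:E)%E.
    apply: eq_integral => t _; apply: ae_eq_integral => //.
    - apply: (measurableT_comp mHi (g := fun w => (add_pt w t, t))).
      apply: measurable_fun_pair => //.
      exact: (measurableT_comp (measurable_add_pt sX) (pair2_measurable t)).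
    - exact: (measurableT_comp mGi (pair2_measurable t)).
    - exists [set w : config X | points w t]; split.
      + rewrite -[X in measurable X]setTI.
        exact: (pair2_measurable t measurableT (measurable_mem_config sX)).
      + exact: fixed_point0 poissonP t.
      + move=> w /= nE; apply: contrapT => wt; apply: nE => _.
        rewrite !indicE; congr (_ : bool)%:R%:E.
        by apply/idP/idP; rewrite !inE /H /G /removal_set/= add_ptK.
  rewrite -(fubini_tonelli (m1 := P) (fun p => (\1_G p)%:E))//.
  transitivity (\int[P]_w (cst 0%E w))%E; last by rewrite integral0.
  apply: ae_eq_integral => //.
    by apply: (measurable_fun_fubini_tonelli_F (m2 := sigma) (fun p => (\1_G p)%:E)) => // p;
      rewrite lee_fin.
  apply: filterS A0 => w Aw0 _ /=.
  transitivity (sigma (A w `&` setT)); last by rewrite setIT.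
  by rewrite -(integral_indic _ measurableT (measurable_random_set rA w)).
have : \forall w \ae P, point_measure w (removal_set A w) = 0%E :> \bar R.
  have [h _] := ae_eq_integral_abs P measurableT (measurable_fun_removal rA).
  have : ae_eq P setT (fun w => point_measure w (removal_set A w) : \bar R) (cst 0%E).
    by apply: h; rewrite -[RHS]int0; apply: eq_integral => w _; rewrite gee0_abs.
  by apply: filterS => w; apply.
apply: filterS => w pm0 t wt At.
move: pm0; rewrite (point_measure_del _ wt) diracE mem_set// => /eqP.
by rewrite padde_eq0//= => /andP[_ /eqP[]/eqP]; rewrite oner_eq0.
Qed.

End random_sets.

Section removal_product.
Context (d : measure_display) (R : realType) (X : borelMetricType d R).
Variables (sigma : {sigma_finite_measure set X -> \bar R}).
Hypothesis sX : sigma_compact X.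
Context (I : finType) (A : I -> config X -> set X) (N : nat) (c : 'I_N -> I).
Hypothesis rA : forall i, random_set (A i).

(** The term of index S in [Delta_inclusion_exclusion] for the indicators of the
random sets. *)
Definition shifted_product (S : {set 'I_N}) (w : config X) (s : N.-tuple X) : R :=
  \prod_(p < N) \1_(A (c p) (add_pts s (enum (S :\ p)%SET) w)) (tnth s p).

Lemma shifted_product_itv S w s : 0 <= shifted_product S w s <= 1.
Proof.
rewrite /shifted_product; apply: (big_ind (fun x : R => 0 <= x <= 1)).
- by rewrite ler01 lexx.
- by move=> x y /andP[x0 x1] /andP[y0 y1]; rewrite mulr_ge0//= mulr_ile1.
- by move=> p _; rewrite indicE; case: (_ \in _); rewrite lexx ler01.
Qed.

Lemma measurable_add_pts (r : seq 'I_N) :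
  measurable_fun setT (fun p : config X * N.-tuple X => add_pts p.2 r p.1).
Proof.
elim: r => [|q r IHr] /=; first exact: measurable_fst.
apply: (measurableT_comp (measurable_add_pt sX)
  (g := fun p : config X * N.-tuple X => (add_pts p.2 r p.1, tnth p.2 q))).
apply: measurable_fun_pair => //.
exact: (measurableT_comp (measurable_tnth q)).
Qed.

Lemma measurable_shifted_product S :
  measurable_fun setT (fun p : config X * N.-tuple X => shifted_product S p.1 p.2).
Proof.
apply: measurable_prod => q _.
apply: (measurableT_comp (@rA (c q))
  (g := fun p : config X * N.-tuple X => (add_pts p.2 (enum (S :\ q)%SET) p.1, tnth p.2 q))).
apply: measurable_fun_pair; first exact: measurable_add_pts.
exact: (measurableT_comp (measurable_tnth q)).
Qed.

Variables (K : set X).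
Hypotheses (cK : compact K) (sK : (sigma K < +oo)%E).

(** Put back the points s_q, q in S \ p: a configuration from which all the s_q, q
in S, have been removed becomes w \ s_p when p is in S, and w otherwise. *)
Lemma mixed_shifted_product (S : {set 'I_N}) w :
  (forall i t, points w t -> removal_set (A i) w t -> K t) ->
  (forall i j t, points w t -> removal_set (A i) w t -> removal_set (A j) w t -> i = j) ->
  mixed_integral sigma K (fun p => p \in S) (fun w s => (shifted_product S w s)%:E) w =
  (mixed_monomial (fun i => npts w (removal_set (A i) w `&` K))
    (fun i => fine (sigma (A i w `&` K))) (fun p => p \in S) c)%:E.
Proof.
move=> wK wdisj; have mK := measurable_compact cK.
rewrite -[X in X%:E]mul1r.
apply: (@mixed_integral_eval _ _ _ sigma K sX cK sK I
  (fun i => removal_set (A i) w `&` K) (fun i => A i w `&` K)) => //.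
- by move=> i; apply: measurableI => //; exact: measurable_removal_set.
- by move=> i; apply: measurableI => //; exact: measurable_random_set.
- by move=> w' s; rewrite lee_fin; case/andP: (shifted_product_itv S w' s).
- by apply/measurable_EFinP; exact: measurable_shifted_product.
- by move=> i j t wt [? _] [? _]; exact: wdisj wt _ _.
move=> s w' Ks ws sinj w'E; rewrite mul1r; congr _%:E; apply: eq_bigr => p _.
have ptsE x : points (add_pts s (enum (S :\ p)%SET) w') x <->
    points w x /\ (p \in S -> x <> tnth s p).
  rewrite points_add_pts w'E; split.
    case=> [[wx xs]|[q]]; first by split => // pS; exact: xs.
    rewrite mem_enum !inE => /andP[qp qS] ->; split; first exact: ws.
    by move=> pS /sinj => /(_ qS pS) /eqP; rewrite (negPf qp).
  move=> [wx xp].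
  have [[q qS xq]|nq] := pselect (exists2 q, q \in S & x = tnth s q).
    right; exists q => //; rewrite mem_enum !inE qS andbT.
    by apply/eqP => qp; apply: xp; rewrite -?qp.
  by left; split => // q qS xq; apply: nq; exists q.
rewrite !indicE; congr (_ : bool)%:R.
case: ifPn => pS.
  have -> : add_pts s (enum (S :\ p)%SET) w' = del_pt w (tnth s p).
    apply: config_eq; apply/seteqP; split => x.
      by move/ptsE => [wx xp]; split => //; exact: xp.
    by move=> [wx xp]; apply/ptsE; split.
  by apply/idP/idP => [/set_mem h|/set_mem[h _]]; apply/mem_set.
have -> : add_pts s (enum (S :\ p)%SET) w' = w.
  apply: config_eq; apply/seteqP; split => x; first by move/ptsE => [].
  by move=> wx; apply/ptsE; split => // pS'; rewrite pS' in pS.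
by apply/idP/idP => [/set_mem h|/set_mem[h _]]; apply/mem_set.
Qed.

End removal_product.

Theorem proposition7p1 (d : measure_display) (R : realType)
    (X : borelMetricType d R)
    (sigma : {sigma_finite_measure set X -> \bar R})
    (P : probability (config X) R)
    (C : nat -> R -> R -> R)
    (K : set X) (n : nat) (A : 'I_n -> config X -> set X) (k : 'I_n -> nat) :
  sigma_compact X ->
  (forall x : X, sigma [set x] = 0%E) ->
  (forall L : set X, compact L -> (sigma L < +oo)%E) ->
  is_poisson sigma P ->
  is_charlier C ->
  compact K ->
  (0 < n)%N ->
  (forall i, random_set (A i)) ->
  (\forall w \ae P, forall i j, i != j -> sigma (A i w `&` A j w) = 0%E) ->
  (\forall w \ae P, forall i, A i w `<=` K) ->
  ('E_P[fun w => (\prod_(i < n)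
           C (k i)
             (skorohod sigma (fun w' t => \1_(A i w') t) w
                + fine (sigma (A i w)))
             (fine (sigma (A i w))))%R]
   = 'E_P[fun w => iter_integral sigma K
            (fun s : (\sum_(i < n) k i).-tuple X =>
               Delta (fun p w' t => \1_(A (block p) w') t) s w)])%E.
Proof.
move=> sX sigma0 slty poissonP charlierC cK _ rA disjA AK.
have mK := measurable_compact cK; have sK := slty _ cK.
pose N := (\sum_(i < n) k i)%N.
pose F (S : {set 'I_N}) w s := (shifted_product A (@block n k) S w s)%:E : \bar R.
pose sgn (S : {set 'I_N}) : R := set_sign R S.
pose mixed (S : {set 'I_N}) := mixed_integral sigma K (fun p => p \in S) (F S).
pose plain (S : {set 'I_N}) := mixed_integral sigma K (fun=> false) (F S).
have F0 S w s : (0 <= F S w s)%E.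
  by rewrite lee_fin; case/andP: (shifted_product_itv A (@block n k) S w s).
have mF S : measurable_fun setT (fun p : config X * N.-tuple X => F S p.1 p.2).
  by apply/measurable_EFinP; exact: measurable_shifted_product.
have mFw S w : measurable_fun setT (shifted_product A (@block n k) S w).
  exact: (measurableT_comp (measurable_shifted_product sX _ rA S) (pair1_measurable w)).
have mmix (S : {set 'I_N}) b : measurable_fun setT (mixed_integral sigma K b (F S)).
  apply: (@measurable_mixed_integral _ _ _ sigma K sX cK N b _ (config X) (fun=> F S) id) => //.
  apply: (measurableT_comp (mF S) (g := fun p : config X * config X * N.-tuple X => (p.1.2, p.2))).
  by apply: measurable_fun_pair => //; apply: measurableT_comp.
have mix0 (S : {set 'I_N}) b w : (0 <= mixed_integral sigma K b (F S) w)%E.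
  exact: mixed_integral_ge0.
have plainE S w : plain S w =
    (iter_integral sigma K (shifted_product A (@block n k) S w))%:E.
  rewrite /plain mixed_integral_false.
  by rewrite (mixed_iter_integral sX cK sK w (mFw S w) (shifted_product_itv A _ S w)).1.
have int_plain S : (\int[P]_w plain S w < +oo)%E.
  apply: (@le_lt_trans _ _ (\int[P]_w (cst (fine (sigma K) ^+ N)%:E w)))%E.
    apply: ge0_le_integral => //.
    - by move=> w _; exact: mix0.
    - exact: mmix.
    move=> w _; rewrite plainE lee_fin.
    by rewrite (mixed_iter_integral sX cK sK w (mFw S w) (shifted_product_itv A _ S w)).2.
  by rewrite integral_cst//= probability_setT mule1 ltry.
have int_mixed S : (\int[P]_w mixed S w = \int[P]_w plain S w)%E.
  exact: (integral_mixed_integral sX cK sigma0 slty poissonP).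
have fplain S := integrable_fine (mmix S (fun=> false)) (mix0 S (fun=> false)) (int_plain S).
have int_mixed_lty S : (\int[P]_w mixed S w < +oo)%E by rewrite int_mixed.
have fmixed S := integrable_fine (mmix S _) (mix0 S _) (int_mixed_lty S).
rewrite !unlock.
(* Both expectations equal that of a signed sum of iterated integrals, almost
   surely for the left-hand side and everywhere for the right-hand side. *)
transitivity (\int[P]_w (\sum_S sgn S * fine (mixed S w))%:E)%E; last first.
  transitivity (\int[P]_w (\sum_S sgn S * fine (plain S w))%:E)%E.
    rewrite (expectation_lincomb sgn (fun S => (fmixed S).1)).
    rewrite (expectation_lincomb sgn (fun S => (fplain S).1)).
    by apply: eq_bigr => S _; rewrite (fmixed S).2 (fplain S).2 int_mixed.
  apply: eq_integral => w _; congr _%:E.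
  rewrite (_ : (fun s : N.-tuple X => _) =
      fun s => \sum_S sgn S * shifted_product A (@block n k) S w s); last first.
    by apply/funext => s; exact: Delta_inclusion_exclusion.
  rewrite (iter_integral_lincomb sX cK sK)//; last by move=> S s; exact: shifted_product_itv.
  by apply: eq_bigr => S _; rewrite plainE.
have disj_removal : \forall w \ae P, forall i j t, points w t ->
    removal_set (A i) w t -> removal_set (A j) w t -> i = j.
  have : \forall w \ae P, forall (ij : 'I_n * 'I_n), ij.1 != ij.2 ->
      forall t, points w t -> ~ (A ij.1 (del_pt w t) `&` A ij.2 (del_pt w t)) t.
    apply: filter_forall => -[i j] /=; have [->|ij] := eqVneq i j; first exact: aeW.
    apply: filterS (mecke_ae sX sigma0 slty poissonP (A := fun w => A i w `&` A j w) _ _).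
    - by move=> w h _.
    - apply: measurable_random_setP.
      by apply: measurableI; exact: measurable_random_graph.
    - by apply: filterS disjA => w; apply.
  apply: filterS => w h i j t wt Ai Aj; apply/eqP/negPn/negP => ij.
  by apply: (h (i, j) ij t wt); split.
have removal_K : \forall w \ae P, forall i t, points w t -> removal_set (A i) w t -> K t.
  have : \forall w \ae P, forall i, forall t, points w t -> ~ (A i (del_pt w t) `\` K) t.
    apply: filter_forall => i.
    apply: (mecke_ae sX sigma0 slty poissonP (A := fun w => A i w `\` K)).
      apply: measurable_random_setP.
      rewrite (_ : [set p | _] = [set p : config X * X | A i p.1 p.2] `\` (setT `*` K)).
        by apply: measurableD; [exact: measurable_random_graph|exact: measurableX].
      by apply/seteqP; split => -[w t] /= [Ap Kp]; split => // h; apply: Kp; [case: h|split].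
    apply: filterS AK => w /(_ i) AiK; rewrite (_ : _ `\` _ = set0) ?measure0//.
    by apply/seteqP; split => // t [At Kt]; apply: Kt; exact: AiK.
  by apply: filterS => w h i t wt Ai; apply: contrapT => Kt; exact: (h i t wt).
apply: ae_eq_integral => //.
- apply/measurable_EFinP; apply: measurable_prod => i _.
  under eq_fun do rewrite (skorohod_indic sX sigma0 (rA i)).
  apply: (measurable_charlier _ charlierC).
  + exact: (measurableT_comp _ (measurable_fun_removal sX (rA i))).
  + exact: (measurableT_comp _ (measurable_fun_sigma_random sigma (rA i))).
  + by move=> w; apply: fine_point_measure_nat; exact: measurable_removal_set.
- apply/measurable_EFinP; apply: measurable_sum => S.
  by apply: measurable_funM => //; exact: (measurableT_comp _ (mmix S _)).
near=> w => _; congr _%:E.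
have wdisj : forall i j t, points w t ->
    removal_set (A i) w t -> removal_set (A j) w t -> i = j by near: w.
have wK : forall i t, points w t -> removal_set (A i) w t -> K t by near: w.
have wAK : forall i, A i w `<=` K by near: w.
pose x i := npts w (removal_set (A i) w `&` K).
pose l i := fine (sigma (A i w `&` K)).
transitivity (\prod_i C (\sum_(p < N) (block p == i))%N (x i)%:R (l i)).
  apply: eq_bigr => i _; rewrite sum_block (skorohod_indic sX sigma0 (rA i)).
  congr (C _ _ _); last by rewrite /l setIidl.
  rewrite -point_measureI (_ : w `&` _ = w `&` (removal_set (A i) w `&` K)).
    by rewrite point_measureI (point_measure_compact _ cK)// => t [].
  by apply/seteqP; split => t [wt]; [move=> At; split => //; split => //; exact: wK wt At|case].
rewrite -(sum_mixed_monomial x l (@block n k) charlierC); apply: eq_bigr => S _.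
by rewrite /mixed (mixed_shifted_product sX _ rA cK sK S wK wdisj).
Unshelve. all: by end_near.
Qed.
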